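(* Let $n\ge1$, $p,q\in\mathbb{Z}_+$, $\omega=(\omega_j)_{0\le j\le q}$ with $\omega_j\in\mathbb{R}_+$, let $\widetilde{A}_{ij}=(\widetilde{A}_{ij}^{rl})_{1\le r,l\le n}$ ($0\le i\le p$, $0\le j\le q$) be square matrices with entries in $\mathcal{G}_{aa}$, let $\widetilde{K}=(\widetilde{K}^{rl})_{1\le r,l\le n}$ be a square matrix with entries in $\mathcal{G}_{L^1}$, and set $$L_\omega\widetilde{u}:=\sum_{i=0}^{p}\sum_{j=0}^{q}\widetilde{A}_{ij}(\tau_{\omega_j}\widetilde{u})^{(i)}+\widetilde{K}*\widetilde{u}.$$ Let $\widetilde{f}=(\widetilde{f}_{aa}+\widetilde{f}_{cor})\in(\mathcal{G}_{aaa})^n$. Then the equation $L_\omega\widetilde{u}=\widetilde{f}$ admits a generalized solution $\widetilde{u}\in(\mathcal{G}_{aaa})^n$ on $\mathbb{J}$ if and only if there exist $\widetilde{v}\in(\mathcal{G}_{aa})^n$ and $\widetilde{w}\in(\mathcal{G}_{+,0})^n$ such that $$L_\omega\widetilde{v}=\widetilde{f}_{aa}\ \text{ on }\ \mathbb{R}\qquad\text{and}\qquad L_\omega\widetilde{w}=\widetilde{f}_{cor}\ \text{ on }\ \mathbb{J}.$$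
   Context: Notation: $\mathbb{Z}_+=\{0,1,2,\dots\}$, $I:=\,]0,1]$, $\mathbb{J}:=[0,+\infty[$, $\mathbb{R}_+=[0,+\infty[$, $\mathbb{I}$ is $\mathbb{R}$ or $\mathbb{J}$. All functions are complex-valued. $\mathcal{C}_b$ is the space of bounded continuous functions on $\mathbb{R}$. A continuous function $g$ on $\mathbb{R}$ is almost automorphic if every real sequence $(s_m)$ has a subsequence $(s_{m_k})_k$ such that $\tilde g(x):=\lim_{k}g(x+s_{m_k})$ exists for every $x\in\mathbb{R}$ and $\lim_k\tilde g(x-s_{m_k})=g(x)$ for every $x\in\mathbb{R}$; $\mathcal{C}_{aa}$ is the space of such functions. $\mathcal{C}_{+,0}$ is the space of $h\in\mathcal{C}_b$ with $\lim_{x\to+\infty}h(x)=0$. $\mathcal{C}_{aaa}$ is the space of $f\in\mathcal{C}_b$ for which there are $g\in\mathcal{C}_{aa}$, $h\in\mathcal{C}_{+,0}$ with $f=g+h$ on $\mathbb{J}$. $\mathcal{D}_{L^p}(\mathbb{I})$ is the space of smooth functions on $\mathbb{I}$ all of whose derivatives lie in $L^p(\mathbb{I})$, with $|\varphi|_{k,p,\mathbb{I}}:=\sum_{j\le k}\|\varphi^{(j)}\|_{L^p(\mathbb{I})}$; $\mathcal{B}(\mathbb{I}):=\mathcal{D}_{L^\infty}(\mathbb{I})$. $\mathcal{B}_{aa}$ (resp. $\mathcal{B}_{aaa}$) is the space of smooth functions on $\mathbb{R}$ all of whose derivatives (including order $0$) lie in $\mathcal{C}_{aa}$ (resp. $\mathcal{C}_{aaa}$).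 $\mathcal{B}_{+,0}$ is the space of $\varphi\in\mathcal{B}(\mathbb{R})$ with $\lim_{x\to+\infty}\varphi^{(j)}(x)=0$ for all $j\in\mathbb{Z}_+$. For a space $X\subset\mathcal{D}_{L^p}(\mathbb{I})$ (with $p=\infty$ for $X=\mathcal{B}_{aaa},\mathcal{B}_{aa},\mathcal{B}_{+,0},\mathcal{B}(\mathbb{I})$ and $p=1$ for $X=\mathcal{D}_{L^1}(\mathbb{R})$), let $\mathcal{M}_X$ be the set of nets $(u_\varepsilon)_{\varepsilon\in I}\in X^I$ such that $\forall k\in\mathbb{Z}_+\,\exists m\in\mathbb{Z}_+$: $|u_\varepsilon|_{k,p,\mathbb{I}}=O(\varepsilon^{-m})$, $\varepsilon\to0$, and $\mathcal{N}_X$ the set of nets in $X^I$ such that $\forall k,m\in\mathbb{Z}_+$: $|u_\varepsilon|_{k,p,\mathbb{I}}=O(\varepsilon^{m})$, $\varepsilon\to0$. Set $\mathcal{G}_X:=\mathcal{M}_X/\mathcal{N}_X$. Then $\mathcal{G}_{aaa},\mathcal{G}_{aa},\mathcal{G}_{+,0},\mathcal{G}_{\mathcal{B}}(\mathbb{I}),\mathcal{G}_{L^1}$ are the quotients for $X=\mathcal{B}_{aaa},\mathcal{B}_{aa},\mathcal{B}_{+,0},\mathcal{B}(\mathbb{I}),\mathcal{D}_{L^1}(\mathbb{R})$; write $\mathcal{N}_{\mathcal{B}}(\mathbb{I}):=\mathcal{N}_{\mathcal{B}(\mathbb{I})}$ and $\mathcal{G}_{\mathcal{B}}:=\mathcal{G}_{\mathcal{B}}(\mathbb{R})$;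 $\mathcal{G}_{aaa},\mathcal{G}_{aa},\mathcal{G}_{+,0}$ are viewed inside $\mathcal{G}_{\mathcal{B}}$. Translation $\tau_\omega u(x):=u(x+\omega)$, derivative, product, and convolution (of an element of $\mathcal{G}_{\mathcal{B}}$ with an element of $\mathcal{G}_{L^1}$) are defined on representatives; on vectors, matrices act in the usual way, so that the $r$-th component of $L_\omega\widetilde{u}$ is $\sum_{l=1}^n\big(\sum_{i=0}^p\sum_{j=0}^q\widetilde{A}_{ij}^{rl}(\tau_{\omega_j}\widetilde{u}_l)^{(i)}+\widetilde{K}^{rl}*\widetilde{u}_l\big)$. Every $\widetilde{f}\in\mathcal{G}_{aaa}$ can be written, uniquely on $\mathbb{J}$, as $\widetilde{f}=\widetilde{f}_{aa}+\widetilde{f}_{cor}$ on $\mathbb{J}$ with $\widetilde{f}_{aa}\in\mathcal{G}_{aa}$ and $\widetilde{f}_{cor}\in\mathcal{G}_{+,0}$; the notation $\widetilde{f}=(\widetilde{f}_{aa}+\widetilde{f}_{cor})\in(\mathcal{G}_{aaa})^n$ refers to this decomposition componentwise. $\widetilde{u}\in(\mathcal{G}_{\mathcal{B}})^n$ is a generalized solution of $L_\omega\widetilde{u}=\widetilde{f}$ on $\mathbb{J}$ if, for representatives $(u_{l,\varepsilon}),(A^{rl}_{ij,\varepsilon}),(K^{rl}_\varepsilon),(f_{r,\varepsilon})$, for each $r=1,\dots,n$ the net of restrictions to $\mathbb{J}$ of $$\sum_{l=1}^{n}\Big(\sum_{i=0}^{p}\sum_{j=0}^{q}A^{rl}_{ij,\varepsilon}(\tau_{\omega_j}u_{l,\varepsilon})^{(i)}+K^{rl}_\varepsilon*u_{l,\varepsilon}\Big)-f_{r,\varepsilon}$$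 belongs to $\mathcal{N}_{\mathcal{B}}(\mathbb{J})$. The equations $L_\omega\widetilde{w}=\widetilde{f}_{cor}$ on $\mathbb{J}$ and $L_\omega\widetilde{v}=\widetilde{f}_{aa}$ on $\mathbb{R}$ are understood in the same way, with $\mathcal{N}_{\mathcal{B}}(\mathbb{J})$ and $\mathcal{N}_{\mathcal{B}}(\mathbb{R})$ respectively. *)

(* Defs.v *)
From mathcomp Require Import all_boot all_order all_algebra.
From mathcomp Require Import complex.
From mathcomp Require Import all_classical all_reals all_analysis.
Set Implicit Arguments.
Unset Strict Implicit.
Unset Printing Implicit Defensive.
Import Order.TTheory GRing.Theory Num.Theory numFieldNormedType.Exports.
Local Open Scope classical_set_scope.
Local Open Scope ring_scope.
Local Open Scope complex_scope.

(* [R[i]^o] carries the usual topology of the complex plane, that of the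
   modulus; note that its norm [`|z|] is valued in [R[i]], while
   [cmod z : R] is the same modulus as a real number. *)
Notation cplx R := (complex R)^o.

Definition cmod (R : realType) (z : cplx R) : R := complex.Re `|z|.

(* The interval of definition of a function is a parameter [D : set R], in
   practice [setT] or [halfline R]: a function on [D] is a function on [R]
   whose values outside [D] are never used, so that restricting a function
   from [R] to [D] is the identity. *)
Definition halfline (R : realType) : set R := `[0, +oo[%classic.
Arguments halfline R : clear implicits.

Section Spaces.
Variable R : realType.
Implicit Types (D : set R) (f g h : R -> cplx R).

(* Derivatives are relative to [D]: for [D = halfline R] the derivative at the
   endpoint 0 is one-sided. *)
Definition diff_quot f (x y : R) : cplx R := (f y - f x) / (y - x)%:C.

Definition derivable_on D f (x : R) : Prop :=
  cvg (diff_quot f x y @[y --> within D x^']).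

Definition deriv_on D f : R -> cplx R :=
  fun x => lim (diff_quot f x y @[y --> within D x^']).

Definition derivn_on D (j : nat) f : R -> cplx R := iter j (deriv_on D) f.

Definition smooth_on D f : Prop :=
  forall (j : nat) (x : R), D x -> derivable_on D (derivn_on D j f) x.

Definition Lp_norm (s : \bar R) D f : \bar R :=
  Lnorm (@lebesgue_measure R) s ((fun x => (cmod (f x))%:E) \_ D).

Definition DLp_seminorm (k : nat) (s : \bar R) D f : \bar R :=
  (\sum_(j < k.+1) Lp_norm s D (derivn_on D j f))%E.

Definition DLp (s : \bar R) D : set (R -> cplx R) :=
  [set f | smooth_on D f /\
           forall j : nat, (Lp_norm s D (derivn_on D j f) < +oo)%E].

Definition Bsp D : set (R -> cplx R) := DLp +oo%E D.

Definition Cb : set (R -> cplx R) :=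
  [set f | continuous f /\ exists M : R, forall x, cmod (f x) <= M].

Definition Caa : set (R -> cplx R) :=
  [set g | continuous g /\
    forall s : nat -> R, exists phi : nat -> nat,
      {homo phi : m k / (m < k)%N} /\
      exists gt : R -> cplx R,
        (forall x, g (x + s (phi k)) @[k --> \oo] --> gt x) /\
        (forall x, gt (x - s (phi k)) @[k --> \oo] --> g x)].

Definition Cplus0 : set (R -> cplx R) :=
  [set h | Cb h /\ h x @[x --> +oo%R] --> (0 : cplx R)].

Definition Caaa : set (R -> cplx R) :=
  [set f | Cb f /\ exists g h : R -> cplx R, [/\ Caa g, Cplus0 h &
     forall x, halfline R x -> f x = g x + h x]].

Definition Baa : set (R -> cplx R) :=
  [set f | smooth_on setT f /\ forall j : nat, Caa (derivn_on setT j f)].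

Definition Baaa : set (R -> cplx R) :=
  [set f | smooth_on setT f /\ forall j : nat, Caaa (derivn_on setT j f)].

Definition Bplus0 : set (R -> cplx R) :=
  [set f | Bsp setT f /\ forall j : nat,
     derivn_on setT j f x @[x --> +oo%R] --> (0 : cplx R)].

Definition translate (w : R) f : R -> cplx R := fun x => f (x + w).

Definition convol f g : R -> cplx R := fun x =>
  (\int[@lebesgue_measure R]_y complex.Re (f y * g (x - y)))%R
  +i* (\int[@lebesgue_measure R]_y complex.Im (f y * g (x - y)))%R.

(* Nets are indexed by ]0, 1]; their values at other indices are never used. *)
Definition net : Type := R -> R -> cplx R.

Section Colombeau.
Variables (s : \bar R) (D : set R) (X : set (R -> cplx R)).

Definition in_net (u : net) : Prop := forall e : R, 0 < e <= 1 -> X (u e).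

(* The seminorms are finite on the spaces considered, whence [fine]. *)
Definition net_seminorm (k : nat) (u : net) : R -> R :=
  fun e => fine (DLp_seminorm k s D (u e)).

Definition moderate_net : set net :=
  [set u | in_net u /\ forall k : nat, exists m : nat,
     net_seminorm k u =O_ (0^'+) (fun e : R => e ^- m)].

Definition negligible_net : set net :=
  [set u | in_net u /\ forall k m : nat,
     net_seminorm k u =O_ (0^'+) (fun e : R => e ^+ m)].

Definition net_class (u : net) : set net :=
  [set v | moderate_net v /\ negligible_net (fun e => v e \- u e)].

(* The quotient of [moderate_net] by [negligible_net]: its elements are the
   classes, and [reps U] is the set of representatives of [U]. *)
Record colombeau : Type := Colombeau {
  reps : set net;
  repsP : exists2 u, moderate_net u & reps = net_class u }.

End Colombeau.

Definition GB : Type := colombeau +oo%E setT (Bsp setT).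
Definition GL1 : Type := colombeau 1%:E setT (DLp 1%:E setT).

(* For a subspace [X] of [Bsp setT], the image in [GB] of the quotient
   associated with [X], under the map sending the class of a net modulo
   negligible nets of [X] to its class modulo negligible nets of [Bsp setT]. *)
Definition viewed_in_GB (X : set (R -> cplx R)) : set GB :=
  [set U | exists V : colombeau +oo%E setT X, reps V `<=` reps U].

Definition Gaa : set GB := viewed_in_GB Baa.
Definition Gaaa : set GB := viewed_in_GB Baaa.
Definition Gplus0 : set GB := viewed_in_GB Bplus0.

Definition entries_in (T : Type) (m n : nat) (S : set T) (U : 'M[T]_(m, n)) :
  Prop := forall i j, S (U i j).

Definition reps_mx (s : \bar R) D (X : set (R -> cplx R)) (m n : nat)
    (U : 'M[colombeau s D X]_(m, n)) : set 'M[net]_(m, n) :=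
  [set u | forall i j, reps (U i j) (u i j)].

(* Equality in the quotient over [D] of the restrictions to [D] of [f] and
   [g + h]. Here and below the condition does not depend on the choice of
   representatives, over which we quantify universally. *)
Definition sum_on D (n : nat) (f g h : 'cV[GB]_n) : Prop :=
  forall fr gr hr : 'cV[net]_n,
    reps_mx f fr -> reps_mx g gr -> reps_mx h hr ->
    forall r : 'I_n, negligible_net +oo%E D (Bsp D)
      (fun e x => fr r ord0 e x - (gr r ord0 e x + hr r ord0 e x)).

Definition L_net (n p q : nat) (omega : 'I_q.+1 -> R)
    (A : 'I_p.+1 -> 'I_q.+1 -> 'M[net]_n) (K : 'M[net]_n)
    (u : 'cV[net]_n) (r : 'I_n) : net := fun e x =>
  \sum_(l < n)
    (\sum_(i < p.+1) \sum_(j < q.+1)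
        A i j r l e x
        * derivn_on setT i (translate (omega j) (u l ord0 e)) x
     + convol (K r l e) (u l ord0 e) x).

Definition generalized_solution D (n p q : nat) (omega : 'I_q.+1 -> R)
    (A : 'I_p.+1 -> 'I_q.+1 -> 'M[GB]_n) (K : 'M[GL1]_n)
    (u f : 'cV[GB]_n) : Prop :=
  forall (ur : 'cV[net]_n) (Ar : 'I_p.+1 -> 'I_q.+1 -> 'M[net]_n)
         (Kr : 'M[net]_n) (fr : 'cV[net]_n),
    reps_mx u ur -> (forall i j, reps_mx (A i j) (Ar i j)) ->
    reps_mx K Kr -> reps_mx f fr ->
    forall r : 'I_n, negligible_net +oo%E D (Bsp D)
      (fun e x => L_net omega Ar Kr ur r e x - fr r ord0 e x).

End Spaces.

Arguments Gaa R : clear implicits.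
Arguments Gaaa R : clear implicits.
Arguments Gplus0 R : clear implicits.

(* Main.v *)
(* Choose representatives u_e in B_aaa of the solution. Each splits as v_e + w_e
   with v_e in B_aa and w_e in B_{+,0}, and as an almost automorphic function
   takes all its values, up to limits, near +oo, the sup norm over R of any
   derivative of v_e is at most that of u_e over [0, +oo[: both nets are
   moderate. Then L v - f_aa is almost automorphic, L w - f_cor vanishes at +oo
   and their sum is negligible on [0, +oo[, so that the same remark makes
   L v - f_aa negligible on the whole of R, and L w - f_cor is negligible on
   [0, +oo[ by difference. The converse is linearity.

   That the derivatives of v_e are the almost automorphic parts of those of u_e
   is obtained from the Taylor bound |u b - u a - (b - a) u' a| <= C (b - a)^2,
   which passes to pointwise limits of translates; the same bound differentiates
   convolutions. *)
Require Import Defs.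
From mathcomp Require Import all_boot all_order all_algebra.
From mathcomp Require Import complex ring.
From mathcomp Require Import all_classical all_reals all_analysis.
From mathcomp Require Import measurable_realfun ess_sup_inf hoelder.
Set Implicit Arguments.
Unset Strict Implicit.
Unset Printing Implicit Defensive.
Import Order.TTheory GRing.Theory Num.Theory numFieldNormedType.Exports.
Local Open Scope classical_set_scope.
Local Open Scope ring_scope.
Local Open Scope complex_scope.


(** The equations are required for every choice of representatives, whereas almost automorphy
    belongs only to well chosen ones: an arbitrary representative of an entry of [A] or of [v] is
    just a moderate net. The comparison of [L v - f_aa] with [L w - f_cor] is therefore made for
    nets taken in [Baa] and [Bplus0], and the passage to other representatives is a separate
    argument: continuity of [L] modulo negligible nets for [v], while any representative of [w]
    completes one of [v] to a representative of [u]. Kernels need no such passage: integrability of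
    each kernel is enough for convolution to preserve almost automorphy and vanishing.

    A convolution sees [u] on the whole line even when the equation lives on [0, +oo[. The splitting
    must then hold on R: the second part is [u - v], not the vanishing function supplied by the
    definition, which is tied to [u] on [0, +oo[ only.

    Bounded, moderate, negligible, almost automorphic and vanishing nets are all treated as
    instances of [smooth_class P], so that stability under [L] is proved once. *)

Section Modulus.
Variable R : realType.
Implicit Types (z w : cplx R).

Lemma norm_cmod z : `|z| = (cmod z)%:C :> R[i].
Proof. by rewrite /cmod normc_def. Qed.

Lemma cmodE z : cmod z = Num.sqrt (complex.Re z ^+ 2 + complex.Im z ^+ 2).
Proof. by rewrite /cmod normc_def. Qed.

Lemma cmod_ge0 z : 0 <= cmod z.
Proof. by rewrite cmodE sqrtr_ge0. Qed.

Lemma cmod0 : cmod (0 : cplx R) = 0.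
Proof. by rewrite /cmod normr0. Qed.

Lemma cmod_real (a : R) : cmod (a%:C : cplx R) = `|a|.
Proof. by rewrite cmodE /= expr0n /= addr0 sqrtr_sqr. Qed.

Lemma cmodM z w : cmod (z * w) = cmod z * cmod w.
Proof.
apply: complexI; rewrite rmorphM /= -!norm_cmod.
exact: (normrM (z : R[i]) w).
Qed.

Lemma cmodD z w : cmod (z + w) <= cmod z + cmod w.
Proof.
rewrite -lecR rmorphD /= -!norm_cmod.
exact: (ler_normD (z : R[i]) w).
Qed.

Lemma cmodN z : cmod (- z) = cmod z.
Proof. by rewrite /cmod normrN. Qed.

Lemma cmodB z w : cmod (z - w) <= cmod z + cmod w.
Proof. by rewrite -(cmodN w) cmodD. Qed.

Lemma cmod_distC z w : cmod (z - w) = cmod (w - z).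
Proof. by rewrite -cmodN opprB. Qed.

Lemma cmod_le_sum z : cmod z <= `|complex.Re z| + `|complex.Im z|.
Proof.
rewrite cmodE -[leRHS]ger0_norm ?addr_ge0// -sqrtr_sqr ler_sqrt ?sqr_ge0//.
rewrite sqrrD !real_normK ?num_real// -subr_ge0.
set a := _ ^+ 2; set b := _ ^+ 2.
rewrite (_ : _ - _ = `|complex.Re z| * `|complex.Im z| *+ 2); last by ring.
by rewrite mulrn_wge0 // mulr_ge0.
Qed.

Lemma Re_le_cmod z : `|complex.Re z| <= cmod z.
Proof.
by rewrite cmodE -sqrtr_sqr ler_sqrt ?addr_ge0 ?sqr_ge0// lerDl sqr_ge0.
Qed.

Lemma Im_le_cmod z : `|complex.Im z| <= cmod z.
Proof.
by rewrite cmodE -sqrtr_sqr ler_sqrt ?addr_ge0 ?sqr_ge0// lerDr sqr_ge0.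
Qed.

Lemma cplx_cvgP T (F : set_system T) (FF : Filter F) (u : T -> cplx R) (l : cplx R) :
  (u x @[x --> F] --> l) <->
  forall eps : R, 0 < eps -> \forall x \near F, cmod (u x - l) < eps.
Proof.
split=> [/cvgrPdist_lt ul eps eps0|ul].
  have e0 : (0 : R[i]) < eps%:C by rewrite ltcR.
  have := ul _ e0; apply: filterS => x.
  by rewrite norm_cmod ltcR cmod_distC.
(* In [R[i]], [0 < eps] forces [eps] to be real, which reduces complex radii to real ones. *)
apply/cvgrPdist_lt => eps; rewrite ltcE /= => /andP[/eqP im0 e0].
have := ul _ e0; apply: filterS => x.
rewrite norm_cmod cmod_distC => h.
by rewrite ltcE /= im0 eqxx.
Qed.

Lemma cplx_cvg_ReImP T (F : set_system T) (FF : Filter F) (u : T -> cplx R) (l : cplx R) :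
  (u x @[x --> F] --> l) <->
  (complex.Re (u x) @[x --> F] --> complex.Re l) /\
  (complex.Im (u x) @[x --> F] --> complex.Im l).
Proof.
rewrite cplx_cvgP; split=> [h|[/cvgrPdist_lt h1 /cvgrPdist_lt h2] eps e0].
  split; apply/cvgrPdist_lt => eps /h; apply: filterS => x; apply: le_lt_trans.
    rewrite distrC (_ : _ - _ = complex.Re (u x - l)); first exact: Re_le_cmod.
    by case: (u x) => ? ?; case: (l) => ? ?.
  rewrite distrC (_ : _ - _ = complex.Im (u x - l)); first exact: Im_le_cmod.
  by case: (u x) => ? ?; case: (l) => ? ?.
have e2 : 0 < eps / 2 by rewrite divr_gt0.
near=> x.
apply: (le_lt_trans (cmod_le_sum _)).
rewrite (splitr eps) ltrD//.
  rewrite (_ : complex.Re _ = complex.Re (u x) - complex.Re l).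
    by rewrite distrC; near: x; exact: h1.
  by case: (u x) => ? ?; case: (l) => ? ?.
rewrite (_ : complex.Im _ = complex.Im (u x) - complex.Im l).
  by rewrite distrC; near: x; exact: h2.
by case: (u x) => ? ?; case: (l) => ? ?.
Unshelve. all: by end_near. Qed.

Lemma cplx_cvg_unique T (F : set_system T) (FF : ProperFilter F)
    (u : T -> cplx R) (a b : cplx R) :
  u x @[x --> F] --> a -> u x @[x --> F] --> b -> a = b.
Proof.
by move=> ha hb; exact: (@cvg_unique _ (@norm_hausdorff _ (cplx R)) _ _ _ _ ha hb).
Qed.

Lemma cplx_cvgM T (F : set_system T) (FF : Filter F) (u v : T -> cplx R) (a b : cplx R) :
  u x @[x --> F] --> a -> v x @[x --> F] --> b ->
  u x * v x @[x --> F] --> (a * b : cplx R).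
Proof. by move=> ha hb; exact: (@cvgM R[i] T F FF u v a b ha hb). Qed.

End Modulus.

(** * Derivatives relative to a set, and jets *)

Section Derivatives.
Variable R : realType.
Implicit Types (f g : R -> cplx R) (D : set R).

(** A relation, because [deriv_on] is a [lim] and has a junk value where the limit fails to exist:
    derivatives are found by exhibiting their value. *)
Definition cderiv D f (x : R) (l : cplx R) : Prop :=
  diff_quot f x y @[y --> within D x^'] --> l.

(** Covers both domains in use. Every point [x] of such a [D] is a limit of points of [D] on its
    right, which makes relative derivatives unique, and every []x, x + e[] lies in [D]. *)
Definition up_closed D := forall x y : R, D x -> x <= y -> D y.

Lemma up_closedT : up_closed setT.
Proof. by []. Qed.

Lemma up_closed_halfline : up_closed (halfline R).
Proof. by move=> x y; rewrite /halfline /= !in_itv /= !andbT; exact: le_trans. Qed.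

Lemma within_dnbhsP D (x : R) (P : set R) : (within D x^') P <->
  exists2 d : R, 0 < d & forall y, D y -> y != x -> `|y - x| < d -> P y.
Proof.
split=> [|[d d0 dP]].
  move=> /nbhs_ballP[d /= d0 dP]; exists d => // y Dy yx xd.
  by apply: dP => //; rewrite -ball_normE /= distrC.
apply/nbhs_ballP; exists d => //= y; rewrite -ball_normE /= distrC => xd yx Dy.
exact: dP.
Qed.

Lemma within_dnbhs_proper D (x : R) : up_closed D -> D x -> ProperFilter (within D x^').
Proof.
move=> uD Dx; apply: Build_ProperFilter_ex => P /within_dnbhsP[d d0 dP].
exists (x + d / 2); apply: dP.
- by apply: uD Dx _; rewrite lerDl divr_ge0 // ltW.
- by rewrite addrC -subr_eq0 addrK gt_eqF // divr_gt0.
- by rewrite addrC addKr gtr0_norm ?divr_gt0 // ltr_pdivrMr// ltr_pMr// ltr1n.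
Qed.

Lemma diff_quotB f (x y : R) (l : cplx R) : y != x ->
  cmod (diff_quot f x y - l) = cmod (f y - f x - (y - x)%:C * l) / `|y - x|.
Proof.
move=> yx; have yx0 : (y - x)%:C != 0 :> R[i].
  by rewrite fmorph_eq0 subr_eq0.
rewrite (_ : diff_quot f x y - l = (f y - f x - (y - x)%:C * l) * ((y - x)^-1)%:C).
  by rewrite cmodM cmod_real normrV // unitfE subr_eq0.
rewrite /diff_quot rmorphV ?unitfE ?subr_eq0 //= [RHS]mulrBl; congr (_ - _).
by rewrite mulrAC divff // mul1r.
Qed.

Lemma cderivP D f x l : cderiv D f x l <->
  forall eps : R, 0 < eps -> exists2 d : R, 0 < d &
    forall y, D y -> `|y - x| < d ->
      cmod (f y - f x - (y - x)%:C * l) <= eps * `|y - x|.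
Proof.
split=> [/cplx_cvgP h eps e0|h].
  have /within_dnbhsP[d d0 dP] := h _ e0; exists d => // y Dy yxd.
  have [->|yx] := eqVneq y x.
    by rewrite !subrr mul0r subr0 cmod0 normr0 mulr0.
  have := dP y Dy yx yxd; rewrite diff_quotB // ltr_pdivrMr ?normr_gt0 ?subr_eq0//.
  exact: ltW.
apply/cplx_cvgP => eps e0; have e2 : 0 < eps / 2 by rewrite divr_gt0.
have [d d0 dP] := h _ e2; apply/within_dnbhsP; exists d => // y Dy yx yxd.
rewrite diff_quotB // ltr_pdivrMr ?normr_gt0 ?subr_eq0//.
apply: le_lt_trans (dP y Dy yxd) _.
by rewrite ltr_pM2r ?normr_gt0 ?subr_eq0// ltr_pdivrMr // ltr_pMr // ltr1n.
Qed.

Lemma cderiv_unique D f x l l' : up_closed D -> D x ->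
  cderiv D f x l -> cderiv D f x l' -> l = l'.
Proof. move=> uD Dx; apply: cplx_cvg_unique; exact: within_dnbhs_proper. Qed.

Lemma cderiv_eqon D D' f g x l : D' `<=` D -> D' x ->
  (forall y, D' y -> f y = g y) -> cderiv D f x l -> cderiv D' g x l.
Proof.
move=> DD Dx fg /cderivP h; apply/cderivP => eps /h[d d0 dP]; exists d => // y Dy yd.
by rewrite -!fg//; apply: dP => //; exact: DD.
Qed.

Lemma cderiv_continuous f x l : cderiv setT f x l -> {for x, continuous f}.
Proof.
move=> /cderivP /(_ 1 ltr01)[d d0 dP]; apply/cplx_cvgP => eps e0.
have c0 : 0 < 1 + cmod l by rewrite ltr_wpDr ?cmod_ge0.
(* The remainder is at most [|y - x|] and the linear term is [|y - x|] times [cmod l], whence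
   [1 + cmod l]. *)
apply/(@nbhs_ballP R R); exists (Num.min d (eps / (1 + cmod l))).
  by rewrite /= lt_min d0 divr_gt0.
move=> y; rewrite -ball_normE /= distrC lt_min => /andP[yd ye].
rewrite -[f y - f x](subrK ((y - x)%:C * l)).
apply: le_lt_trans (cmodD _ _) _.
apply: le_lt_trans (lerD (dP y I yd) (lexx _)) _.
by rewrite cmodM cmod_real mulrC -mulrDr -ltr_pdivlMr.
Qed.

Lemma cderivD D f g x a b : cderiv D f x a -> cderiv D g x b ->
  cderiv D (fun y => f y + g y) x (a + b).
Proof.
move=> /cderivP hf /cderivP hg; apply/cderivP => eps e0.
have e2 : 0 < eps / 2 by rewrite divr_gt0.
have [d d0 dP] := hf _ e2; have [d' d'0 dP'] := hg _ e2.
exists (Num.min d d'); first by rewrite lt_min d0.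
move=> y Dy; rewrite lt_min => /andP[yd yd'].
rewrite (_ : _ - _ = (f y - f x - (y - x)%:C * a) + (g y - g x - (y - x)%:C * b));
  last by ring.
apply: le_trans (cmodD _ _) _; rewrite (splitr eps) mulrDl lerD//; [exact: dP|exact: dP'].
Qed.

Lemma cderivN D f x a : cderiv D f x a -> cderiv D (fun y => - f y) x (- a).
Proof.
move=> /cderivP h; apply/cderivP => eps /h[d d0 dP]; exists d => // y Dy yd.
rewrite (_ : _ - _ = - (f y - f x - (y - x)%:C * a)); last by ring.
by rewrite cmodN dP.
Qed.

Lemma cderiv_cst D (c : cplx R) x : cderiv D (fun=> c) x 0.
Proof.
apply/cderivP => eps e0; exists 1 => // y _ _.
by rewrite subrr mulr0 subr0 cmod0 mulr_ge0 // ltW.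
Qed.

Lemma cderivM f g x a b : cderiv setT f x a -> cderiv setT g x b ->
  cderiv setT (fun y => f y * g y) x (a * g x + f x * b).
Proof.
move=> hf hg.
rewrite /cderiv (_ : diff_quot _ x = fun y => diff_quot f x y * g y + f x * diff_quot g x y);
  last by apply/funext => y; rewrite /diff_quot; ring.
apply: cvgD.
  apply: cplx_cvgM hf _; apply: cvg_within_filter; apply: cvg_within_filter.
  exact: cderiv_continuous hg.
apply: cplx_cvgM hg; exact: cvg_cst.
Qed.

Lemma cderiv_translate f (w x : R) l :
  cderiv setT f (x + w) l -> cderiv setT (translate w f) x l.
Proof.
move=> /cderivP h; apply/cderivP => eps /h[d d0 dP]; exists d => // y _ yd.
have e : y + w - (x + w) = y - x by ring.
by have := dP (y + w) I; rewrite e; exact.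
Qed.

(** A bound with a fixed constant survives pointwise limits and integration against a kernel, where
    the bare existence of a derivative would not. *)
Lemma cderiv_quadratic D f x l (M : R) :
  (forall y, D y -> cmod (f y - f x - (y - x)%:C * l) <= M * (y - x) ^+ 2) ->
  cderiv D f x l.
Proof.
move=> h; apply/cderivP => eps e0.
have M0 : 0 < `|M| + 1 by rewrite ltr_wpDl.
exists (eps / (`|M| + 1)); first by rewrite divr_gt0.
move=> y Dy yd; apply: le_trans (h y Dy) _.
rewrite -[(y - x) ^+ 2]real_normK ?num_real// expr2 mulrA ler_wpM2r//.
rewrite ltr_pdivlMr // mulrC in yd; apply: le_trans (ltW yd).
by rewrite ler_wpM2r // (le_trans (ler_norm _))// lerDl.
Qed.

(** [F] is a candidate for the whole sequence of derivatives. Checking the single rule from [F j] to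
    [F j.+1] gives smoothness and all iterated derivatives at once, without handling iterated
    limits. *)
Definition jet D f (F : nat -> R -> cplx R) :=
  (forall x, D x -> F 0%N x = f x) /\
  forall j x, D x -> cderiv D (F j) x (F j.+1 x).

Lemma smooth_jet D f : smooth_on D f -> jet D f (fun j => derivn_on D j f).
Proof.
move=> sf; split=> // j x Dx; exact: (sf j x Dx).
Qed.

Lemma jet_derivn D f F : up_closed D -> jet D f F ->
  forall j x, D x -> derivn_on D j f x = F j x.
Proof.
move=> uD [F0 FS]; elim=> [|j IH] x Dx; first by rewrite /= F0.
have h : cderiv D (derivn_on D j f) x (F j.+1 x).
  by apply: (@cderiv_eqon D D (F j)) => // [y /IH //|]; exact: FS.
apply: (cderiv_unique uD Dx _ h); apply: (cvgP (F j.+1 x)); exact: h.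
Qed.

Lemma jet_smooth D f F : up_closed D -> jet D f F -> smooth_on D f.
Proof.
move=> uD jf j x Dx; apply: (cvgP (F j.+1 x)).
apply: (@cderiv_eqon D D (F j)) => // [y Dy|]; first by rewrite (jet_derivn uD jf).
exact: jf.2.
Qed.

Lemma jet_derivnT f F : jet setT f F -> forall j, derivn_on setT j f = F j.
Proof.
by move=> jf j; apply/funext => x; exact: (jet_derivn up_closedT jf).
Qed.

Lemma jet_restrict D f F : jet setT f F -> jet D f F.
Proof.
move=> [F0 FS]; split=> [x _|j x Dx]; first exact: F0.
by apply: (@cderiv_eqon setT D (F j)) => //; exact: FS.
Qed.

End Derivatives.

(** * Taylor bound with quadratic remainder for complex-valued functions *)

Section Taylor.
Variable R : realType.
Implicit Types (f g : R -> cplx R).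

Lemma Re_remainder (z w l : cplx R) (a : R) :
  complex.Re (z - w - a%:C * l) = complex.Re z - complex.Re w - a * complex.Re l.
Proof. by case: z w l => ? ? [? ?] [? ?] /=; ring. Qed.

Lemma Im_remainder (z w l : cplx R) (a : R) :
  complex.Im (z - w - a%:C * l) = complex.Im z - complex.Im w - a * complex.Im l.
Proof. by case: z w l => ? ? [? ?] [? ?] /=; ring. Qed.

(** [c] is located by its distance to [a] only, so that both orders of [a] and [b] are covered. *)
Lemma real_mean_value (f df : R -> R) (a b : R) :
  (forall x : R, is_derive x 1 f (df x)) ->
  exists2 c, `|c - a| <= `|b - a| & f b - f a = df c * (b - a).
Proof.
move=> fdf.
have fc (u v : R) : {within `[u, v], continuous f}.
  apply: continuous_subspaceT => x.
  by apply: differentiable_continuous; apply/derivable1_diffP; case: (fdf x).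
have [ab|ba|->] := ltgtP a b; last by exists b; rewrite ?subrr ?mulr0.
- have [c] := MVT ab (fun x _ => fdf x) (fc a b).
  rewrite in_itv /= => /andP[ac cb] e; exists c => //.
  by rewrite !ger0_norm ?subr_ge0 ?ltW// ltrD2r.
- have [c] := MVT ba (fun x _ => fdf x) (fc b a).
  rewrite in_itv /= => /andP[bc ca] e; exists c => //.
    rewrite distrC (distrC b) !ger0_norm ?subr_ge0 ?ltW//.
    by rewrite ltrD2l ltrN2.
  by rewrite -opprB e -mulrN opprB.
Qed.

(** Two mean values: the remainder is [(b - a) * (f1 c - f1 a)], then [(b - a) * (c - a) * f2 d],
    with [c] no farther from [a] than [b] is. *)
Lemma real_taylor1 (f f1 f2 : R -> R) (M a b : R) :
  (forall x : R, is_derive x 1 f (f1 x)) -> (forall x : R, is_derive x 1 f1 (f2 x)) ->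
  (forall x, `|f2 x| <= M) ->
  `|f b - f a - (b - a) * f1 a| <= M * (b - a) ^+ 2.
Proof.
move=> d1 d2 fM.
have [c ca ->] := real_mean_value a b d1.
rewrite mulrC -mulrBr.
have [d da ->] := real_mean_value a c d2.
rewrite !normrM -[(b - a) ^+ 2]real_normK ?num_real// mulrC expr2 mulrA ler_wpM2r//.
by rewrite ler_pM.
Qed.

Lemma is_derive_of_bound (f : R -> R) (x l : R) :
  (forall eps : R, 0 < eps -> exists2 d : R, 0 < d &
    forall y, `|y - x| < d -> `|f y - f x - (y - x) * l| <= eps * `|y - x|) ->
  is_derive x 1 f l.
Proof.
move=> h.
have L : h^-1 *: ((f \o shift x) (h *: (1 : R)) - f x) @[h --> 0^'] --> l.
  apply/cvgrPdist_le => eps /h[d d0 dP].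
  apply/nbhs_ballP; exists d => //= y; rewrite -ball_normE /= sub0r normrN => yd y0.
  have := dP (y + x); rewrite addrK => /(_ yd) hy.
  rewrite distrC -(ler_pM2l (x := `|y|)) ?normr_gt0// -normrM mulrBr.
  rewrite /GRing.scale /= mulrA divff // mul1r mulr1 [leRHS]mulrC.
  exact: hy.
apply: DeriveDef; first exact: (cvgP l L).
exact: (cvg_lim _ L).
Qed.

Lemma cderiv_is_derive_Re f x l : cderiv setT f x l ->
  is_derive x 1 (fun y => complex.Re (f y)) (complex.Re l).
Proof.
move=> /cderivP h; apply: is_derive_of_bound => eps /h[d d0 dP]; exists d => // y yd.
by apply: le_trans (dP y I yd); rewrite -Re_remainder; exact: Re_le_cmod.
Qed.

Lemma cderiv_is_derive_Im f x l : cderiv setT f x l ->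
  is_derive x 1 (fun y => complex.Im (f y)) (complex.Im l).
Proof.
move=> /cderivP h; apply: is_derive_of_bound => eps /h[d d0 dP]; exists d => // y yd.
by apply: le_trans (dP y I yd); rewrite -Im_remainder; exact: Im_le_cmod.
Qed.

(** The mean value theorem fails for complex values; applying the real bound to real and imaginary
    parts separately costs the factor 2. *)
Lemma taylor1 f f1 f2 (M : R) :
  (forall x, cderiv setT f x (f1 x)) -> (forall x, cderiv setT f1 x (f2 x)) ->
  (forall x, cmod (f2 x) <= M) -> forall a b : R,
  cmod (f b - f a - (b - a)%:C * f1 a) <= M *+ 2 * (b - a) ^+ 2.
Proof.
move=> d1 d2 fM a b; apply: le_trans (cmod_le_sum _) _.
rewrite mulr2n mulrDl lerD//.
  have := @real_taylor1 _ _ _ M a b (fun x => cderiv_is_derive_Re (d1 x))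
    (fun x => cderiv_is_derive_Re (d2 x))
    (fun x => le_trans (Re_le_cmod _) (fM x)).
  by rewrite -Re_remainder.
have := @real_taylor1 _ _ _ M a b (fun x => cderiv_is_derive_Im (d1 x))
  (fun x => cderiv_is_derive_Im (d2 x))
  (fun x => le_trans (Im_le_cmod _) (fM x)).
by rewrite -Im_remainder.
Qed.

End Taylor.

(** * Jets of sums, opposites, translates and products *)

Section SmoothAlgebra.
Variable R : realType.
Implicit Types (f g : R -> cplx R).
Let S f := smooth_on setT f.
Let d (j : nat) f : R -> cplx R := derivn_on setT j f.

Lemma smooth_derivn f i : S f -> S (d i f).
Proof. by move=> sf j x _; rewrite /d /derivn_on -iterD; exact: sf. Qed.

Lemma derivnA f i j : d j (d i f) = d (j + i) f.
Proof. by rewrite /d /derivn_on iterD. Qed.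

Lemma smooth_cderiv f j x : S f -> cderiv setT (d j f) x (d j.+1 f x).
Proof. by move=> /smooth_jet[_]; exact. Qed.

Lemma smooth_continuous f : S f -> continuous f.
Proof. by move=> sf x; exact: (cderiv_continuous (@smooth_cderiv f 0 x sf)). Qed.

Lemma jetD f g : S f -> S g -> jet setT (fun x => f x + g x) (fun j x => d j f x + d j g x).
Proof.
move=> sf sg; split=> [x _|j x _]; first exact: erefl.
exact (cderivD (@smooth_cderiv f j x sf) (@smooth_cderiv g j x sg)).
Qed.

Lemma jetN f : S f -> jet setT (fun x => - f x) (fun j x => - d j f x).
Proof.
move=> sf; split=> [x _|j x _]; first exact: erefl.
exact (cderivN (@smooth_cderiv f j x sf)).
Qed.

Lemma jet0 : jet setT (fun=> 0 : cplx R) (fun _ => fun=> 0).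
Proof.
split=> [x _|j x _]; first exact: erefl.
exact (cderiv_cst setT 0 x).
Qed.

Lemma jet_translate f w : S f -> jet setT (translate w f) (fun j => translate w (d j f)).
Proof.
move=> sf; split=> [x _|j x _]; first exact: erefl.
exact (cderiv_translate (@smooth_cderiv f j (x + w) sf)).
Qed.

(** The Leibniz formula with its [2 ^ j] terms kept apart: without binomial coefficients, a class
    closed under sums that contains the elementary products contains the derivatives of products by
    plain induction. *)
Fixpoint leibniz (j : nat) (F G : nat -> R -> cplx R) : R -> cplx R :=
  if j is j'.+1 then fun x => leibniz j' (fun k => F k.+1) G x + leibniz j' F (fun k => G k.+1) x
  else fun x => F 0%N x * G 0%N x.

Lemma cderiv_leibniz j F G :
  (forall k x, cderiv setT (F k) x (F k.+1 x)) ->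
  (forall k x, cderiv setT (G k) x (G k.+1 x)) ->
  forall x, cderiv setT (leibniz j F G) x (leibniz j.+1 F G x).
Proof.
elim: j F G => [|j IH] F G hF hG x.
  exact (cderivM (hF 0%N x) (hG 0%N x)).
exact (cderivD (IH (fun k => F k.+1) G (fun k => hF k.+1) hG x)
  (IH F (fun k => G k.+1) hF (fun k => hG k.+1) x)).
Qed.

Lemma jetM f g : S f -> S g ->
  jet setT (fun x => f x * g x) (fun j => leibniz j (d^~ f) (d^~ g)).
Proof.
move=> sf sg; split=> [x _|j x _]; first exact: erefl.
exact (@cderiv_leibniz j _ _ (fun k y => @smooth_cderiv f k y sf)
  (fun k y => @smooth_cderiv g k y sg) x).
Qed.
End SmoothAlgebra.

(** * Complex integrals against an integrable kernel *)

Section ComplexIntegral.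
Variable R : realType.
Let mu := @lebesgue_measure R.
Implicit Types (f g h K : R -> cplx R).

Definition cmeasurable f :=
  measurable_fun setT (fun y => complex.Re (f y)) /\
  measurable_fun setT (fun y => complex.Im (f y)).

Lemma ReD (z w : cplx R) : complex.Re (z + w) = complex.Re z + complex.Re w.
Proof. by case: z w => ? ? []. Qed.

Lemma ImD (z w : cplx R) : complex.Im (z + w) = complex.Im z + complex.Im w.
Proof. by case: z w => ? ? []. Qed.

Lemma ReM (z w : cplx R) : complex.Re (z * w) =
  complex.Re z * complex.Re w - complex.Im z * complex.Im w.
Proof. by case: z w => ? ? []. Qed.

Lemma ImM (z w : cplx R) : complex.Im (z * w) =
  complex.Re z * complex.Im w + complex.Im z * complex.Re w.
Proof. by case: z w => ? ? []. Qed.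

Lemma continuous_Re f : continuous f -> continuous (fun y => complex.Re (f y)).
Proof. by move=> cf x; have /cplx_cvg_ReImP[] := cf x. Qed.

Lemma continuous_Im f : continuous f -> continuous (fun y => complex.Im (f y)).
Proof. by move=> cf x; have /cplx_cvg_ReImP[] := cf x. Qed.

Lemma continuous_cmod f : continuous f -> continuous (fun y => cmod (f y)).
Proof.
move=> cf x; rewrite /continuous_at.
under eq_fun do rewrite cmodE; rewrite cmodE.
apply: (@continuous_comp R R R (fun y => complex.Re (f y) ^+ 2 + complex.Im (f y) ^+ 2)
  Num.sqrt); last exact: sqrt_continuous.
apply: cvgD; rewrite expr2; under eq_fun do rewrite expr2; apply: cvgM.
- exact: continuous_Re.
- exact: continuous_Re.
- exact: continuous_Im.
- exact: continuous_Im.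
Qed.

Lemma cmeasurable_continuous f : continuous f -> cmeasurable f.
Proof.
move=> cf; split; apply: continuous_measurable_fun.
  exact: continuous_Re.
exact: continuous_Im.
Qed.

Lemma cmeasurable_reflect f x : cmeasurable f -> cmeasurable (fun y => f (x - y)).
Proof.
move=> [m1 m2]; have mx : measurable_fun setT (fun y : R => x - y).
  exact: measurable_funB.
by split; [apply: (measurableT_comp m1 mx) | apply: (measurableT_comp m2 mx)].
Qed.

Lemma cmeasurableD f g : cmeasurable f -> cmeasurable g ->
  cmeasurable (fun y => f y + g y).
Proof.
move=> [f1 f2] [g1 g2]; split.
  by under eq_fun do rewrite ReD; exact: measurable_funD.
by under eq_fun do rewrite ImD; exact: measurable_funD.
Qed.

Lemma cmeasurableM f g : cmeasurable f -> cmeasurable g ->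
  cmeasurable (fun y => f y * g y).
Proof.
move=> [f1 f2] [g1 g2]; split.
  under eq_fun do rewrite ReM.
  by apply: measurable_funB; exact: measurable_funM.
under eq_fun do rewrite ImM.
by apply: measurable_funD; exact: measurable_funM.
Qed.

Lemma cmeasurable_cst (c : cplx R) : cmeasurable (fun=> c).
Proof. by split; exact: measurable_cst. Qed.

Lemma cmeasurable_cvg (f_ : nat -> R -> cplx R) f :
  (forall k, cmeasurable (f_ k)) -> (forall y, f_ k y @[k --> \oo] --> f y) ->
  cmeasurable f.
Proof.
move=> mf ff; split.
  apply: (@measurable_fun_cvg _ _ _ setT (fun k y => complex.Re (f_ k y))).
    by move=> k; exact: (mf k).1.
  by move=> y _; have /cplx_cvg_ReImP[] := ff y.
apply: (@measurable_fun_cvg _ _ _ setT (fun k y => complex.Im (f_ k y))).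
  by move=> k; exact: (mf k).2.
by move=> y _; have /cplx_cvg_ReImP[] := ff y.
Qed.

Definition cint f : cplx R :=
  (\int[mu]_y complex.Re (f y))%R +i* (\int[mu]_y complex.Im (f y))%R.

Lemma convolE K f x : convol K f x = cint (fun y => K y * f (x - y)).
Proof. by []. Qed.

Definition L1fun K :=
  cmeasurable K /\ mu.-integrable setT (fun y => (cmod (K y))%:E).

Definition L1norm K : R := (\int[mu]_y cmod (K y))%R.

Lemma L1norm_ge0 K : 0 <= L1norm K.
Proof. by apply: Rintegral_ge0 => y _; exact: cmod_ge0. Qed.

Definition cbounded f (M : R) := forall y, cmod (f y) <= M.

(** Stated for a real [u] so as to serve both the real and the imaginary part of [K y * f y]. *)
Lemma L1_dominated K f M (u : R -> R) : L1fun K -> cbounded f M ->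
  measurable_fun setT u -> (forall y, `|u y| <= cmod (K y * f y)) ->
  mu.-integrable setT (EFin \o u) /\ `|\int[mu]_y u y|%R <= L1norm K * M.
Proof.
move=> [mK iK] fM mu_ ub.
have ub' y : `|u y| <= cmod (K y) * M.
  by apply: le_trans (ub y) _; rewrite cmodM ler_wpM2l ?cmod_ge0.
have iKM : mu.-integrable setT (fun y => (cmod (K y) * M)%:E).
  apply: eq_integrable (integrableZr _ M iK) => //.
have iu : mu.-integrable setT (EFin \o u).
  apply: le_integrable iKM => //; first exact/measurable_EFinP.
  by move=> y _; rewrite /= lee_fin (le_trans (ub' y))// ler_norm.
split=> //; apply: le_trans (le_normr_Rintegral measurableT iu) _.
rewrite /L1norm -RintegralZr//.
apply: le_Rintegral => //; exact: integrable_norm.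
Qed.

Lemma L1_integrable K f M : L1fun K -> cmeasurable f -> cbounded f M ->
  mu.-integrable setT (EFin \o (fun y => complex.Re (K y * f y))) /\
  mu.-integrable setT (EFin \o (fun y => complex.Im (K y * f y))).
Proof.
move=> LK mf fM; have [m1 m2] := cmeasurableM LK.1 mf; split.
  by have [] := L1_dominated LK fM m1 (fun y => Re_le_cmod _).
by have [] := L1_dominated LK fM m2 (fun y => Im_le_cmod _).
Qed.

(** Real and imaginary parts are bounded separately, hence the factor 2. *)
Lemma cint_bound K f M : L1fun K -> cmeasurable f -> cbounded f M ->
  cmod (cint (fun y => K y * f y)) <= L1norm K * M *+ 2.
Proof.
move=> LK mf fM; have [m1 m2] := cmeasurableM LK.1 mf.
apply: le_trans (cmod_le_sum _) _; rewrite mulr2n lerD//=.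
  by have [] := L1_dominated LK fM m1 (fun y => Re_le_cmod _).
by have [] := L1_dominated LK fM m2 (fun y => Im_le_cmod _).
Qed.

Lemma cintD K f g M N : L1fun K -> cmeasurable f -> cbounded f M ->
  cmeasurable g -> cbounded g N ->
  cint (fun y => K y * (f y + g y)) =
  cint (fun y => K y * f y) + cint (fun y => K y * g y).
Proof.
move=> LK mf fM mg gN.
have [f1 f2] := L1_integrable LK mf fM; have [g1 g2] := L1_integrable LK mg gN.
rewrite /cint; congr (_ +i* _).
  by rewrite -RintegralD//; apply: eq_Rintegral => y _; rewrite mulrDr ReD.
by rewrite -RintegralD//; apply: eq_Rintegral => y _; rewrite mulrDr ImD.
Qed.

Lemma cintZ K f M (c : R) : L1fun K -> cmeasurable f -> cbounded f M ->
  cint (fun y => K y * (c%:C * f y)) = c%:C * cint (fun y => K y * f y).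
Proof.
move=> LK mf fM; have [f1 f2] := L1_integrable LK mf fM.
rewrite /cint /=; apply/eqP; rewrite eq_complex /= !mul0r subr0 addr0.
rewrite -!RintegralZl//; apply/andP; split; apply/eqP; apply: eq_Rintegral => y _.
  by rewrite mulrCA ReM /= mul0r subr0.
by rewrite mulrCA ImM /= mul0r addr0.
Qed.

Lemma Rintegral_cvg (h_ : nat -> R -> R) (h G : R -> R) :
  (forall k, measurable_fun setT (h_ k)) -> measurable_fun setT h ->
  (forall y, h_ k y @[k --> \oo] --> h y) ->
  mu.-integrable setT (EFin \o G) -> (forall k y, `|h_ k y| <= G y) ->
  (\int[mu]_y h_ k y)%R @[k --> \oo] --> (\int[mu]_y h y)%R.
Proof.
move=> mh_ mh hh iG hG.
have mE k : measurable_fun setT (EFin \o h_ k) by exact/measurable_EFinP.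
have mE' : measurable_fun setT (EFin \o h) by exact/measurable_EFinP.
have hE : {ae mu, forall y, setT y -> (EFin \o h_ k) y @[k --> \oo] --> (EFin \o h) y}.
  by apply: aeW => y _; apply: cvg_EFin; [exact: nearW|exact: hh].
have hGE : {ae mu, forall y k, setT y -> (`|(EFin \o h_ k) y| <= (EFin \o G) y)%E}.
  by apply: aeW => y k _; rewrite /= lee_fin.
have [ih _ c] := @dominated_convergence _ _ R mu setT measurableT _ _ _ mE mE' hE iG hGE.
apply: fine_cvg; rewrite fineK //.
exact: integrable_fin_num.
Qed.

Lemma cint_cvg K (f_ : nat -> R -> cplx R) f M : L1fun K ->
  (forall k, cmeasurable (f_ k)) -> (forall k, cbounded (f_ k) M) ->
  (forall y, f_ k y @[k --> \oo] --> f y) ->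
  cint (fun y => K y * f_ k y) @[k --> \oo] --> cint (fun y => K y * f y).
Proof.
move=> LK mf fM ff; have mf' := cmeasurable_cvg mf ff.
have iKM : mu.-integrable setT (fun y => (cmod (K y) * M)%:E).
  by apply: eq_integrable (integrableZr _ M LK.2).
have KM k y : cmod (K y * f_ k y) <= cmod (K y) * M.
  by rewrite cmodM; apply: ler_wpM2l; [exact: cmod_ge0|exact: fM].
have KC y : K y * f_ k y @[k --> \oo] --> (K y * f y : cplx R).
  by apply: cplx_cvgM (ff y); exact: cvg_cst.
apply/cplx_cvg_ReImP; split => /=; apply: (Rintegral_cvg _ _ _ iKM).
- by move=> k; exact: (cmeasurableM LK.1 (mf k)).1.
- exact: (cmeasurableM LK.1 mf').1.
- by move=> y; have /cplx_cvg_ReImP[] := KC y.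
- by move=> k y; exact: le_trans (Re_le_cmod _) (KM k y).
- by move=> k; exact: (cmeasurableM LK.1 (mf k)).2.
- exact: (cmeasurableM LK.1 mf').2.
- by move=> y; have /cplx_cvg_ReImP[] := KC y.
- by move=> k y; exact: le_trans (Im_le_cmod _) (KM k y).
Qed.

End ComplexIntegral.

(** * Convolution with an integrable kernel and its derivatives *)

Section Convolution.
Variable R : realType.
Implicit Types (f g K : R -> cplx R).
Local Notation S := (smooth_on setT).
Local Notation d := (derivn_on setT).

Lemma convol_bound K f M : L1fun K -> cmeasurable f -> cbounded f M ->
  cbounded (convol K f) (L1norm K * M *+ 2).
Proof.
move=> LK mf fM x; rewrite convolE; apply: cint_bound => //.
exact: cmeasurable_reflect.
Qed.

Lemma convolD K f g M N : L1fun K -> cmeasurable f -> cbounded f M ->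
  cmeasurable g -> cbounded g N -> forall x,
  convol K (fun y => f y + g y) x = convol K f x + convol K g x.
Proof.
move=> LK mf fM mg gN x; rewrite !convolE.
exact: (cintD LK (cmeasurable_reflect x mf) (fun y => fM _)
  (cmeasurable_reflect x mg) (fun y => gN _)).
Qed.

Lemma convol0 f x : convol (fun=> 0) f x = 0.
Proof.
rewrite convolE /cint.
rewrite (_ : \int[_]_y _ = 0); last first.
  under eq_Rintegral do rewrite mul0r /=.
  by rewrite /Rintegral integral0.
rewrite (_ : \int[_]_y _ = 0)//.
under eq_Rintegral do rewrite mul0r /=.
by rewrite /Rintegral integral0.
Qed.

Lemma cmeasurable_smooth f : S f -> cmeasurable f.
Proof. by move=> sf; apply: cmeasurable_continuous; exact: smooth_continuous. Qed.

(** By linearity this remainder is the convolution of [K] with the remainder of [f], which is at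
    most [N] everywhere. The bounds [M] and [M1] provide the integrability that splitting the
    integral requires. *)
Lemma convol_remainder K f f1 M M1 (N a b : R) : L1fun K ->
  cmeasurable f -> cbounded f M -> cmeasurable f1 -> cbounded f1 M1 ->
  (forall y, cmod (f (b - y) - f (a - y) - (b - a)%:C * f1 (a - y)) <= N) ->
  cmod (convol K f b - convol K f a - (b - a)%:C * convol K f1 a) <=
    L1norm K * N *+ 2.
Proof.
move=> LK mf fM mf1 f1M hN; rewrite !convolE.
have mb := cmeasurable_reflect b mf; have ma := cmeasurable_reflect a mf.
have m1 := cmeasurable_reflect a mf1.
have Zb (g : R -> cplx R) (c L : R) : cbounded g L ->
    cbounded (fun y => c%:C * g y) (`|c| * L).
  by move=> gL y; rewrite cmodM cmod_real ler_wpM2l.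
have Zm (g : R -> cplx R) (c : R) : cmeasurable g -> cmeasurable (fun y => c%:C * g y).
  by move=> mg; apply: cmeasurableM mg; exact: cmeasurable_cst.
have Ba : cbounded (fun y => f (a - y)) M by move=> y; exact: fM.
have Bb : cbounded (fun y => f (b - y)) M by move=> y; exact: fM.
have B1 : cbounded (fun y => f1 (a - y)) M1 by move=> y; exact: f1M.
rewrite (_ : _ - _ - _ = cint (fun y => K y * (f (b - y) +
    ((-1)%:C * f (a - y) + (- (b - a))%:C * f1 (a - y))))).
  apply: cint_bound => //.
    by apply: cmeasurableD => //; apply: cmeasurableD; exact: Zm.
  move=> y; rewrite (_ : _ + _ = f (b - y) - f (a - y) - (b - a)%:C * f1 (a - y))//.
  by rewrite !rmorphN /= rmorph1; ring.
have Ca := cintZ (-1) LK ma Ba; have C1 := cintZ (- (b - a)) LK m1 B1.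
have Da := cintD LK (Zm _ (-1) ma) (Zb _ (-1) _ Ba)
  (Zm _ (- (b - a)) m1) (Zb _ (- (b - a)) _ B1).
rewrite (cintD (N := `|-1| * M + `|- (b - a)| * M1) LK mb Bb); last first.
- by move=> y; apply: le_trans (cmodD _ _) _; rewrite lerD// ?Zb.
- by apply: cmeasurableD; exact: Zm.
by rewrite Da Ca C1 !rmorphN /= rmorph1; ring.
Qed.

(** Every derivative falls on [f], so integrability of [K] suffices. At order [j] the quadratic
    bound rests on the bound [M2] of the derivative of order [j + 2]. *)
Lemma jet_convol K f : L1fun K -> S f -> (forall j, exists M, cbounded (d j f) M) ->
  jet setT (convol K f) (fun j => convol K (d j f)).
Proof.
move=> LK sf bf; split=> [x _|j x _]; first exact: erefl.
have [M fM] := bf j; have [M1 f1M] := bf j.+1; have [M2 f2M] := bf j.+2.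
have m j' : cmeasurable (d j' f) by apply: cmeasurable_smooth; exact: smooth_derivn.
apply: (@cderiv_quadratic _ _ _ _ _ (L1norm K * (M2 *+ 2) *+ 2)) => y _.
rewrite mulrnAl -mulrA.
apply: (convol_remainder LK (m j) fM (m j.+1) f1M) => z.
have := taylor1 (fun x => @smooth_cderiv _ f j x sf)
  (fun x => @smooth_cderiv _ f j.+1 x sf) f2M (x - z) (y - z).
by rewrite (_ : y - z - (x - z) = y - x)//; ring.
Qed.

End Convolution.

(** * Sup norms and seminorms as pointwise bounds *)

Section Seminorms.
Variable R : realType.
Implicit Types (f g : R -> cplx R) (D : set R).
Local Notation S := (smooth_on setT).
Local Notation d := (derivn_on setT).
Let mu := @lebesgue_measure R.

(** The norm of exponent [+oo] unfolds to an essential supremum only when the whole space has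
    positive measure. *)
Lemma lebesgue_measure_setT_gt0 : (0 < mu setT)%E.
Proof.
apply: (@lt_le_trans _ _ (mu `]0, 1[%classic)).
  by rewrite /mu lebesgue_measure_itv /= lte_fin ltr01 -EFinB lte_fin subr0.
by apply: le_measure => //; rewrite inE.
Qed.

Lemma eq_Lp_norm s D f g : (forall x, D x -> f x = g x) -> Lp_norm s D f = Lp_norm s D g.
Proof.
move=> fg; rewrite /Lp_norm; congr Lnorm; apply/funext => x; rewrite !patchE.
by case: ifPn => // /set_mem /fg ->.
Qed.

(** [0 <= M] takes care of the points outside [D], where the patched function is 0. *)
Lemma Lp_norm_infty_le D f (M : R) : 0 <= M ->
  (forall x, D x -> cmod (f x) <= M) -> (Lp_norm +oo D f <= M%:E)%E.
Proof.
move=> M0 fM; rewrite /Lp_norm unlock lebesgue_measure_setT_gt0.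
apply/ess_supP; apply: aeW => x; rewrite /= patchE.
case: ifPn => [/set_mem /fM fx|_]; last by rewrite abse0 lee_fin.
by rewrite lee_fin ger0_norm // cmod_ge0.
Qed.

(** A value above [M] at [x] would persist by continuity on some []x, x + e[], which lies in [D] and
    has positive measure. *)
Lemma Lp_norm_infty_ge D f (M : R) : up_closed D -> continuous f ->
  (Lp_norm +oo D f <= M%:E)%E -> forall x, D x -> cmod (f x) <= M.
Proof.
move=> uD cf; rewrite /Lp_norm unlock lebesgue_measure_setT_gt0.
move=> /ess_supP[N [mN N0 sN]] x Dx; rewrite leNgt; apply/negP => Mx.
have := @continuous_cmod _ f cf x; move=> /cvgrPdist_lt /(_ (cmod (f x) - M)).
rewrite subr_gt0 => /(_ Mx) /nbhs_ballP[e /= e0 eP].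
have sub : `]x, x + e[%classic `<=` N.
  move=> y; rewrite /= in_itv /= => /andP[xy ye]; apply: sN => /=.
  have Dy : D y by apply: uD Dx (ltW xy).
  rewrite patchE mem_set // /= lee_fin ger0_norm ?cmod_ge0// => yM.
  have := eP y; rewrite -ball_normE /= distrC ger0_norm ?subr_ge0 ?(ltW xy)//.
  rewrite ltrBlDl => /(_ ye); rewrite ltNge => /negP; apply.
  by apply: le_trans (ler_norm _); rewrite lerD2l lerN2.
have : (mu `]x, (x + e)%R[%classic <= mu N)%E by apply: le_measure => //; rewrite inE.
rewrite [mu N]N0 /mu lebesgue_measure_itv /= lte_fin ltrDl e0 -EFinB addrC addKr lee_fin.
by rewrite leNgt e0.
Qed.

Definition bounded_on D f := exists M : R, forall x, D x -> cmod (f x) <= M.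

(** For a function smooth on R, the one-sided derivative at the endpoint of the half-line agrees
    with the two-sided one, so restrictions can be estimated through derivatives over R. *)
Lemma derivn_restrict D f j x : up_closed D -> S f -> D x ->
  derivn_on D j f x = d j f x.
Proof.
move=> uD sf; apply: (jet_derivn uD); apply: jet_restrict; exact: smooth_jet.
Qed.

Lemma smooth_restrict D f : up_closed D -> S f -> smooth_on D f.
Proof.
move=> uD sf; apply: (jet_smooth uD); apply: jet_restrict; exact: smooth_jet sf.
Qed.

Lemma bounded_onW D f : bounded_on D f ->
  exists2 M : R, 0 <= M & forall x, D x -> cmod (f x) <= M.
Proof.
move=> [M fM]; exists `|M| => // x Dx.
by apply: le_trans (fM x Dx) _; exact: ler_norm.
Qed.

Lemma Lp_norm_derivn D f j : up_closed D -> S f ->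
  Lp_norm +oo D (derivn_on D j f) = Lp_norm +oo D (d j f).
Proof. by move=> uD sf; apply: eq_Lp_norm => x; exact: derivn_restrict. Qed.

Lemma continuous_derivn f j : S f -> continuous (d j f).
Proof. by move=> sf; apply: smooth_continuous; exact: smooth_derivn. Qed.

Lemma Lp_norm_fin D f : up_closed D -> continuous f ->
  (Lp_norm +oo D f < +oo)%E <-> bounded_on D f.
Proof.
move=> uD cf; split=> [h|/bounded_onW[M M0 fM]].
  have h0 : (0 <= Lp_norm +oo D f)%E by rewrite /Lp_norm Lnorm_ge0.
  exists (fine (Lp_norm +oo D f)); apply: Lp_norm_infty_ge => //.
  by rewrite fineK // ge0_fin_numE.
exact: le_lt_trans (Lp_norm_infty_le M0 fM) (ltry _).
Qed.

Lemma BspP D f : up_closed D -> S f ->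
  Bsp D f <-> forall j, bounded_on D (d j f).
Proof.
move=> uD sf; split=> [[_ h] j|h].
  apply/Lp_norm_fin => //; first exact: continuous_derivn.
  by rewrite -Lp_norm_derivn.
split=> [|j]; first exact: smooth_restrict.
by rewrite Lp_norm_derivn//; apply/Lp_norm_fin => //; exact: continuous_derivn.
Qed.

(** Boundedness of the derivatives makes the seminorm finite; [fine] would send [+oo] to 0. *)
Lemma seminorm_ge D f k : up_closed D -> S f -> (forall j, bounded_on D (d j f)) ->
  forall j x, (j <= k)%N -> D x -> cmod (d j f x) <= fine (DLp_seminorm k +oo D f).
Proof.
move=> uD sf bf j x jk.
have fin i : (Lp_norm +oo D (derivn_on D i f) \is a fin_num)%E.
  rewrite Lp_norm_derivn// ge0_fin_numE ?/Lp_norm ?Lnorm_ge0//.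
  by apply/(Lp_norm_fin uD); [exact: continuous_derivn|exact: bf].
apply: (Lp_norm_infty_ge uD); first exact: continuous_derivn.
rewrite -Lp_norm_derivn// fineK; last by apply/sum_fin_numP => i _ _; exact: fin.
rewrite /DLp_seminorm (bigD1 (Ordinal (jk : (j < k.+1)%N)))//= leeDl// sume_ge0// => i _.
by rewrite /Lp_norm Lnorm_ge0.
Qed.

Lemma seminorm_le D f k (M : R) : up_closed D -> S f -> 0 <= M ->
  (forall j x, (j <= k)%N -> D x -> cmod (d j f x) <= M) ->
  0 <= fine (DLp_seminorm k +oo D f) <= M *+ k.+1.
Proof.
move=> uD sf M0 fM.
have s0 : (0 <= DLp_seminorm k +oo D f)%E.
  by rewrite /DLp_seminorm sume_ge0// => i _; rewrite /Lp_norm Lnorm_ge0.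
have sM : (DLp_seminorm k +oo D f <= (M *+ k.+1)%:E)%E.
  rewrite -[k.+1 in leRHS]card_ord -sumr_const -sumEFin; apply: lee_sum => i _.
  rewrite Lp_norm_derivn//; apply: Lp_norm_infty_le => // x Dx.
  by apply: fM => //; rewrite -ltnS.
rewrite fine_ge0//= -lee_fin fineK// ge0_fin_numE//.
exact: le_lt_trans sM (ltry _).
Qed.

End Seminorms.

(** * Growth of nets as the index tends to 0 *)

Section NetGrowth.
Variable R : realType.
Implicit Types (u v : net R) (D : set R).
Local Notation S := (smooth_on setT).
Local Notation d := (derivn_on setT).

Definition dnet j u : net R := fun e => d j (u e).

Definition dominated_net D u (r : R -> R) := exists C : R,
  \forall e \near 0^'+, forall x, D x -> cmod (u e x) <= C * r e.

Definition bounded_net D u := forall e, 0 < e <= 1 -> bounded_on D (u e).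

Definition smooth_net u := forall e, 0 < e <= 1 -> S (u e).

Lemma near0_unit : \forall e \near (0 : R)^'+, 0 < e <= 1.
Proof.
near=> e; apply/andP; split; near: e; first exact: nbhs_right_gt.
exact: nbhs_right_le.
Unshelve. all: by end_near. Qed.

Lemma dominated_net_ge0 D u r : dominated_net D u r -> (forall e, 0 < e -> 0 <= r e) ->
  exists2 C : R, 0 <= C &
  \forall e \near 0^'+, forall x, D x -> cmod (u e x) <= C * r e.
Proof.
move=> [C uC] r0; exists `|C| => //; near=> e => x Dx.
apply: (@le_trans _ _ (C * r e)).
  by move: x Dx; near: e.
rewrite ler_wpM2r ?ler_norm// r0//; near: e; exact: nbhs_right_gt.
Unshelve. all: by end_near. Qed.

(** Trades the big O of a sum of sup norms for a uniform pointwise bound on each derivative, the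
    form in which moderate and negligible nets are handled afterwards. *)
Lemma net_seminormO D u k (r : R -> R) : up_closed D -> smooth_net u ->
  (forall j, bounded_net D (dnet j u)) -> (forall e, 0 < e -> 0 <= r e) ->
  (net_seminorm +oo D k u =O_ (0^'+) r) <->
  forall j, (j <= k)%N -> dominated_net D (dnet j u) r.
Proof.
move=> uD su bu r0; split=> [/eqO_exP[C C0 uC] j jk|h].
  exists C; near=> e => x Dx.
  have e1 : 0 < e <= 1 by near: e; exact: near0_unit.
  have := seminorm_ge (f := u e) (k := k) uD (su e e1) (fun j => bu j e e1) jk Dx.
  move/le_trans; apply; apply: le_trans (ler_norm _) _.
  rewrite -[r e]ger0_norm; first by near: e; exact: uC.
  by apply: r0; case/andP: e1.
(* One constant and one neighbourhood of 0 for all orders up to [k], obtained by adding the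
   constants. *)
have {h} [C C0 hC] : exists2 C, 0 <= C & \forall e \near 0^'+, forall j x,
    (j <= k)%N -> D x -> cmod (dnet j u e x) <= C * r e.
  elim: k h => [|k IH] h.
    have [C C0 hC] := dominated_net_ge0 (h 0%N isT) r0; exists C => //.
    near=> e => j x; rewrite leqn0 => /eqP ->; move: x; near: e; exact: hC.
  have [|C C0 hC] := IH; first by move=> j jk; apply: h; exact: leqW.
  have [C' C'0 hC'] := dominated_net_ge0 (h k.+1 (leqnn _)) r0.
  exists (C + C'); first exact: addr_ge0.
  near=> e => j x; have re : 0 <= r e.
    by apply: r0; near: e; exact: nbhs_right_gt.
  rewrite mulrDl leq_eqVlt => /orP[/eqP ->|jk] Dx.
    apply: ler_wpDl; first exact: mulr_ge0.
    by move: x Dx; near: e; exact: hC'.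
  apply: ler_wpDr; first exact: mulr_ge0.
  by move: j x jk Dx; near: e; exact: hC.
(* [eqO_exP] asks for a positive constant, hence [C + 1]; the factor [k.+1] counts the terms of the
   seminorm. *)
apply/eqO_exP; exists ((C + 1) *+ k.+1).
  by rewrite pmulrn_lgt0// ltr_wpDl.
near=> e.
have e1 : 0 < e <= 1 by near: e; exact: near0_unit.
have re : 0 <= r e by apply: r0; case/andP: e1.
have hM j x : (j <= k)%N -> D x -> cmod (d j (u e) x) <= (C + 1) * r e.
  move=> jk Dx; apply: (@le_trans _ _ (C * r e)); last by rewrite ler_wpM2r// lerDl.
  by move: j x jk Dx; near: e; exact: hC.
have M0 : 0 <= (C + 1) * r e by rewrite mulr_ge0// addr_ge0.
have /andP[s0 sM] := seminorm_le uD (su e e1) M0 hM.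
by rewrite ger0_norm// [`|r e|]ger0_norm// mulrnAl.
Unshelve. all: by end_near. Qed.

End NetGrowth.

(** * Classes of nets given by a condition on every derivative *)

Section SmoothClasses.
Variable R : realType.
Implicit Types (u v K : net R) (D : set R) (P Q T : set (net R)).
Local Notation S := (smooth_on setT).
Local Notation d := (derivn_on setT).

(** Since [P] is imposed on every derivative, a closure property of [smooth_class P] has to be
    checked on [P] alone, once the jet of the operation is known. *)
Definition smooth_class P : set (net R) :=
  [set u | smooth_net u /\ forall j, P (dnet j u)].

(* Nets are only controlled on ]0, 1], so that the rules of differentiation
   identify nets there and nowhere else. *)
Definition local_class P := forall u v,
  (forall e, 0 < e <= 1 -> u e = v e) -> P u -> P v.

Definition net_add_closed P := forall u v, P u -> P v -> P (fun e x => u e x + v e x).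

(** Moderateness at order 0, as [small] is negligibility at order 0. Boundedness holds at every
    index of ]0, 1], the power bound only near 0. *)
Definition tempered D : set (net R) :=
  [set u | bounded_net D u /\ exists m : nat, dominated_net D u (fun e => e ^- m)].

Definition small D : set (net R) :=
  [set u | bounded_net D u /\ forall m : nat, dominated_net D u (fun e => e ^+ m)].

Lemma exprV_leD (e : R) m k : 0 < e <= 1 -> e ^- m <= e ^- (m + k).
Proof.
move=> /andP[e0 e1]; rewrite lef_pV2 ?posrE ?exprn_gt0// exprD.
by apply: ler_piMr; [rewrite exprn_ge0// ltW|apply: exprn_ile1 => //; exact: ltW].
Qed.

Lemma dominated_net_local D u v r : (forall e, 0 < e <= 1 -> u e = v e) ->
  dominated_net D u r -> dominated_net D v r.
Proof.
move=> uv [C uC]; exists C; near=> e => x Dx; rewrite -uv; last first.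
  by near: e; exact: near0_unit.
by move: x Dx; near: e.
Unshelve. all: by end_near. Qed.

Lemma bounded_net_local D : local_class (bounded_net D).
Proof. by move=> u v uv bu e e1; rewrite -uv//; exact: bu. Qed.

Lemma tempered_local D : local_class (tempered D).
Proof.
move=> u v uv [bu [m um]]; split; first exact: bounded_net_local bu.
by exists m; exact: dominated_net_local um.
Qed.

Lemma small_local D : local_class (small D).
Proof.
move=> u v uv [bu um]; split; first exact: bounded_net_local bu.
by move=> m; exact: dominated_net_local (um m).
Qed.

Lemma smooth_class_local P : local_class P -> local_class (smooth_class P).
Proof.
move=> lP u v uv [su Pu]; split=> [e e1|j]; first by rewrite -uv//; exact: su.
by apply: lP (Pu j) => e e1; rewrite /dnet uv.
Qed.

Lemma smooth_classS P Q : P `<=` Q -> smooth_class P `<=` smooth_class Q.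
Proof. by move=> PQ u [su Pu]; split=> // j; exact: PQ. Qed.

Lemma smooth_class_add P : local_class P -> net_add_closed P ->
  net_add_closed (smooth_class P).
Proof.
move=> lP aP u v [su Pu] [sv Pv]; split=> [e e1|j].
  exact: jet_smooth (jetD (su e e1) (sv e e1)).
apply: lP (aP _ _ (Pu j) (Pv j)) => e e1.
by rewrite /dnet (jet_derivnT (jetD (su e e1) (sv e e1))).
Qed.

Lemma smooth_class_opp P : local_class P ->
  (forall u, P u -> P (fun e x => - u e x)) ->
  forall u, smooth_class P u -> smooth_class P (fun e x => - u e x).
Proof.
move=> lP oP u [su Pu]; split=> [e e1|j]; first exact: jet_smooth (jetN (su e e1)).
apply: lP (oP _ (Pu j)) => e e1.
by rewrite /dnet (jet_derivnT (jetN (su e e1))).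
Qed.

Lemma smooth_class0 P : P (fun _ _ => 0) -> smooth_class P (fun _ _ => 0).
Proof.
move=> P0; split=> [e e1|j]; first exact: jet_smooth (jet0 R).
rewrite (_ : dnet j _ = fun _ _ => 0)//; apply/funext => e.
exact: (jet_derivnT (jet0 R)).
Qed.

Lemma smooth_class_mul P Q T : local_class T -> net_add_closed T ->
  (forall u v, P u -> Q v -> T (fun e x => u e x * v e x)) ->
  forall u v, smooth_class P u -> smooth_class Q v ->
    smooth_class T (fun e x => u e x * v e x).
Proof.
move=> lT aT mT u v [su Pu] [sv Qv]; split=> [e e1|j].
  exact: jet_smooth (jetM (su e e1) (sv e e1)).
(* Quantified over all sequences [F] and [G], because the recursion of [leibniz] shifts them. *)
have lb (F G : nat -> net R) : (forall k, P (F k)) -> (forall k, Q (G k)) ->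
    T (fun e => leibniz j (F^~ e) (G^~ e)).
  elim: j F G => [|j IH] F G PF QG /=; first exact: mT.
  apply: aT; first exact: (IH (fun k => F k.+1)).
  exact: (IH F (fun k => G k.+1)).
apply: lT (lb _ _ Pu Qv) => e e1.
by rewrite /dnet (jet_derivnT (jetM (su e e1) (sv e e1))).
Qed.

Lemma smooth_class_translate P w : local_class P ->
  (forall u, P u -> P (fun e => translate w (u e))) ->
  forall u, smooth_class P u -> smooth_class P (fun e => translate w (u e)).
Proof.
move=> lP tP u [su Pu]; split=> [e e1|j].
  exact: jet_smooth (jet_translate w (su e e1)).
apply: lP (tP _ (Pu j)) => e e1.
by rewrite /dnet (jet_derivnT (jet_translate w (su e e1))).
Qed.

Lemma smooth_class_derivn P i u : smooth_class P u -> smooth_class P (dnet i u).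
Proof.
move=> [su Pu]; split=> [e e1|j]; first exact: smooth_derivn (su e e1).
rewrite (_ : dnet j _ = dnet (j + i) u)//.
by apply/funext => e; rewrite /dnet derivnA.
Qed.

Lemma smooth_class_convol P Q K : local_class Q ->
  (forall e, 0 < e <= 1 -> L1fun (K e)) -> P `<=` bounded_net setT ->
  (forall u, smooth_net u -> P u -> Q (fun e => convol (K e) (u e))) ->
  forall u, smooth_class P u -> smooth_class Q (fun e => convol (K e) (u e)).
Proof.
move=> lQ LK Pb cPQ u [su Pu].
have jc e : 0 < e <= 1 -> jet setT (convol (K e) (u e)) (fun j => convol (K e) (d j (u e))).
  move=> e1; apply: jet_convol; [exact: LK|exact: su|move=> j].
  by have [M uM] := Pb _ (Pu j) e e1; exists M => x; exact: uM.
split=> [e e1|j]; first exact: jet_smooth (jc e e1).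
apply: lQ (cPQ _ _ (Pu j)) => e e1.
  by rewrite /dnet (jet_derivnT (jc e e1)).
exact: smooth_derivn (su e e1).
Qed.

(** All that is retained of a moderate net of kernels: in a convolution the derivatives are put on
    the other factor, so those of the kernel never occur. *)
Definition L1_net K := (forall e, 0 < e <= 1 -> L1fun (K e)) /\
  exists m C, \forall e \near 0^'+, L1norm (K e) <= C * e ^- m.

Lemma dominated_net_add D u v r : dominated_net D u r -> dominated_net D v r ->
  dominated_net D (fun e x => u e x + v e x) r.
Proof.
move=> [C uC] [C' vC]; exists (C + C'); near=> e => x Dx.
apply: le_trans (cmodD _ _) _; rewrite mulrDl lerD//.
  by move: x Dx; near: e.
by move: x Dx; near: e.
Unshelve. all: by end_near. Qed.

Lemma dominated_netW D u r r' : dominated_net D u r -> (forall e, 0 < e -> 0 <= r e) ->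
  (forall e, 0 < e <= 1 -> r e <= r' e) -> dominated_net D u r'.
Proof.
move=> ur r0 rr'; have [C C0 uC] := dominated_net_ge0 ur r0.
exists C; near=> e => x Dx.
apply: (@le_trans _ _ (C * r e)); first by move: x Dx; near: e.
by rewrite ler_wpM2l// rr'//; near: e; exact: near0_unit.
Unshelve. all: by end_near. Qed.

Lemma bounded_net_add D : net_add_closed (bounded_net D).
Proof.
move=> u v bu bv e e1; have [M uM] := bu e e1; have [N vN] := bv e e1.
exists (M + N) => x Dx; apply: le_trans (cmodD _ _) _.
by rewrite lerD ?uM ?vN.
Qed.

Lemma bounded_net_opp D u : bounded_net D u -> bounded_net D (fun e x => - u e x).
Proof. by move=> bu e /bu[M uM]; exists M => x; rewrite cmodN; exact: uM. Qed.

Lemma bounded_net_mul D u v : bounded_net D u -> bounded_net D v ->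
  bounded_net D (fun e x => u e x * v e x).
Proof.
move=> bu bv e e1; have [M uM] := bu e e1; have [N vN] := bv e e1.
exists (M * N) => x Dx; rewrite cmodM ler_pM ?cmod_ge0//; [exact: uM|exact: vN].
Qed.

Lemma bounded_net0 D : bounded_net D (fun _ _ => 0).
Proof. by move=> e _; exists 0 => x _; rewrite cmod0. Qed.

Lemma bounded_net_translate w u : bounded_net setT u ->
  bounded_net setT (fun e => translate w (u e)).
Proof. by move=> bu e /bu[M uM]; exists M => x _; exact: uM. Qed.

Lemma bounded_net_convol K u : (forall e, 0 < e <= 1 -> L1fun (K e)) ->
  smooth_net u -> bounded_net setT u ->
  bounded_net setT (fun e => convol (K e) (u e)).
Proof.
move=> LK su bu e e1; have [M uM] := bu e e1; exists (L1norm (K e) * M *+ 2) => x _.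
apply: convol_bound (LK e e1) _ _ x; first exact: cmeasurable_smooth (su e e1).
by move=> y; exact: uM.
Qed.

Lemma small0 D : small D (fun _ _ => 0).
Proof.
split=> [|m]; first exact: bounded_net0.
by exists 0; near=> e => x _; rewrite cmod0 mul0r.
Unshelve. all: by end_near. Qed.

Lemma small_add D : net_add_closed (small D).
Proof.
move=> u v [bu um] [bv vm]; split=> [|m]; first exact: bounded_net_add.
exact: dominated_net_add.
Qed.

Lemma small_opp D u : small D u -> small D (fun e x => - u e x).
Proof.
move=> [bu um]; split=> [|m]; first exact: bounded_net_opp.
have [C uC] := um m; exists C; near=> e => x Dx; rewrite cmodN.
by move: x Dx; near: e.
Unshelve. all: by end_near. Qed.

Lemma small_sub D D' u : D' `<=` D -> small D u -> small D' u.
Proof.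
move=> DD [bu um]; split=> [e /bu[M uM]|m]; first by exists M => x /DD; exact: uM.
have [C uC] := um m; exists C; near=> e => x /DD; move: x; near: e; exact: uC.
Unshelve. all: by end_near. Qed.

Lemma tempered_add D : net_add_closed (tempered D).
Proof.
move=> u v [bu [m um]] [bv [k vk]]; split; first exact: bounded_net_add.
exists (m + k)%N; apply: dominated_net_add.
  apply: dominated_netW um _ _ => e; first by move=> e0; rewrite invr_ge0 exprn_ge0// ltW.
  exact: exprV_leD.
apply: dominated_netW vk _ _ => e; first by move=> e0; rewrite invr_ge0 exprn_ge0// ltW.
by rewrite addnC; exact: exprV_leD.
Qed.

Lemma tempered_opp D u : tempered D u -> tempered D (fun e x => - u e x).
Proof.
move=> [bu [m [C uC]]]; split; first exact: bounded_net_opp.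
exists m, C; near=> e => x Dx; rewrite cmodN.
by move: x Dx; near: e.
Unshelve. all: by end_near. Qed.

Lemma small_tempered D u : small D u -> tempered D u.
Proof.
move=> [bu um]; split=> //; exists 0%N.
by apply: dominated_netW (um 0%N) _ _ => e e0; rewrite !expr0 ?invr1.
Qed.

Lemma tempered_translate w u : tempered setT u ->
  tempered setT (fun e => translate w (u e)).
Proof.
move=> [bu [m [C uC]]]; split; first exact: bounded_net_translate.
exists m, C; near=> e => x _.
suff : forall x, setT x -> cmod (u e x) <= C * e ^- m by apply.
by near: e.
Unshelve. all: by end_near. Qed.

Lemma small_translate w u : small setT u -> small setT (fun e => translate w (u e)).
Proof.
move=> [bu um]; split=> [|m]; first exact: bounded_net_translate.
have [C uC] := um m; exists C; near=> e => x _.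
suff : forall x, setT x -> cmod (u e x) <= C * e ^+ m by apply.
by near: e.
Unshelve. all: by end_near. Qed.

Lemma tempered_mul_small D u v : tempered D u -> small D v ->
  small D (fun e x => u e x * v e x).
Proof.
move=> [bu [k [C uC]]] [bv vm]; split=> [|m]; first exact: bounded_net_mul.
(* The extra [k] powers of [e] absorb the growth [e ^- k] of [u]. *)
have [C' vC] := vm (k + m)%N; exists (C * C'); near=> e => x Dx.
have e0 : 0 < e by near: e; exact: nbhs_right_gt.
rewrite cmodM (_ : C * C' * _ = (C * e ^- k) * (C' * e ^+ (k + m))).
  by rewrite ler_pM ?cmod_ge0//; move: x Dx; near: e.
by rewrite mulrACA exprD mulKf// expf_neq0// gt_eqF.
Unshelve. all: by end_near. Qed.

Lemma small_mul_tempered D u v : small D u -> tempered D v ->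
  small D (fun e x => u e x * v e x).
Proof.
move=> su tv; have := tempered_mul_small tv su.
by congr (small D _); apply/funext => e; apply/funext => x; rewrite mulrC.
Qed.

Lemma small_convol K u : L1_net K -> smooth_net u -> small setT u ->
  small setT (fun e => convol (K e) (u e)).
Proof.
move=> [LK [k [C KC]]] su [bu um]; split=> [|m]; first exact: bounded_net_convol.
have [C' C'0 uC] := dominated_net_ge0 (um (k + m)%N) (fun e e0 => exprn_ge0 _ (ltW e0)).
exists (C * C' *+ 2); near=> e => x _.
have e1 : 0 < e <= 1 by near: e; exact: near0_unit.
have e0 : 0 < e by case/andP: e1.
have uM : cbounded (u e) (C' * e ^+ (k + m)).
  by move=> y; have : setT y by []; move: y; near: e.
apply: le_trans (convol_bound (LK e e1) (cmeasurable_smooth (su e e1)) uM x) _.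
rewrite mulrnAl lerMn2r /=; rewrite (_ : C * C' * _ = (C * e ^- k) * (C' * e ^+ (k + m))).
  rewrite ler_wpM2r ?mulr_ge0 ?exprn_ge0 ?(ltW e0)//; near: e; exact: KC.
by rewrite mulrACA exprD mulKf// expf_neq0// gt_eqF.
Unshelve. all: by end_near. Qed.

Lemma sub_Bsp_smooth (X : set (R -> cplx R)) u : X `<=` Bsp setT -> in_net X u ->
  smooth_net u /\ forall j, bounded_net setT (dnet j u).
Proof.
move=> XB Xu; split=> [e /Xu/XB[]//|j e e1].
exact: ((BspP (@up_closedT R) (XB _ (Xu e e1)).1).1 (XB _ (Xu e e1)) j).
Qed.

(** A seminorm needs one exponent for all orders up to [k], while [tempered] gives one for each
    order: the exponents are added up by induction on [k]. *)
Lemma moderate_netP (X : set (R -> cplx R)) u : X `<=` Bsp setT ->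
  moderate_net +oo setT X u <-> in_net X u /\ smooth_class (tempered setT) u.
Proof.
move=> XB.
have r0 m (e : R) : 0 < e -> 0 <= e ^- m by move=> e0; rewrite invr_ge0 exprn_ge0 ?ltW.
split=> [[Xu um]|[Xu [su tu]]].
  have [su bu] := sub_Bsp_smooth XB Xu; split=> //; split=> // j; split=> //.
  have [m /(net_seminormO _ (@up_closedT R) su bu (r0 m)) h] := um j.
  by exists m; apply: h.
split=> // k; have bu j : bounded_net setT (dnet j u) by have [] := tu j.
suff [m h] : exists m, forall j, (j <= k)%N -> dominated_net setT (dnet j u) (fun e => e ^- m).
  by exists m; apply/(net_seminormO _ (@up_closedT R) su bu (r0 m)).
elim: k => [|k [m h]].
  by have [_ [m um]] := tu 0%N; exists m => j; rewrite leqn0 => /eqP ->.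
have [_ [m' um']] := tu k.+1; exists (m + m')%N => j; rewrite leq_eqVlt => /orP[/eqP->|jk].
  by apply: dominated_netW um' (r0 _) _ => e; rewrite addnC; exact: exprV_leD.
by apply: dominated_netW (h j jk) (r0 _) _ => e; exact: exprV_leD.
Qed.

(** As [u] is smooth on all of R, its derivatives relative to [D] are those over R, and
    negligibility on [D] becomes a condition on [dnet j u]. *)
Lemma negligible_onP D u : up_closed D -> smooth_net u ->
  negligible_net +oo D (Bsp D) u <-> smooth_class (small D) u.
Proof.
move=> uD su; split=> [[Xu um]|[_ tu]].
  have bu j : bounded_net D (dnet j u).
    by move=> e e1; exact: ((BspP uD (su e e1)).1 (Xu e e1) j).
  split=> // j; split=> // m.
  have r0 (e : R) : 0 < e -> 0 <= e ^+ m by move=> e0; exact: exprn_ge0 (ltW e0).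
  exact: ((net_seminormO j uD su bu r0).1 (um j m) j (leqnn j)).
have bu j : bounded_net D (dnet j u) by have [] := tu j.
split=> [e e1|k m]; first by apply/(BspP uD); [exact: su|move=> j; exact: bu].
apply/(net_seminormO _ uD su bu (fun e e0 => exprn_ge0 m (ltW e0))) => j _.
by have [] := tu j.
Qed.

Lemma negligible_netP (X : set (R -> cplx R)) u : X `<=` Bsp setT ->
  negligible_net +oo setT X u <-> in_net X u /\ smooth_class (small setT) u.
Proof.
move=> XB; split=> [[Xu um]|[Xu ts]].
  split=> //; apply/negligible_onP => //; first by have [] := sub_Bsp_smooth XB Xu.
  by split=> // e /Xu/XB.
split=> //; have : negligible_net +oo setT (Bsp setT) u.
  by apply/negligible_onP => //; case: ts.
by case.
Qed.

Lemma moderate_L1_net K : moderate_net 1%:E setT (DLp 1%:E setT) K -> L1_net K.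
Proof.
move=> [XK mK].
have LK e : 0 < e <= 1 -> L1fun (K e) /\ Lp_norm 1%:E setT (K e) = (L1norm (K e))%:E.
  move=> e1; have [sK nK] := XK e e1.
  have cK : cmeasurable (K e) by exact: cmeasurable_smooth.
  have mc : measurable_fun setT (fun y => (cmod (K e y))%:E).
    apply/measurable_EFinP; apply: continuous_measurable_fun.
    by apply: continuous_cmod; exact: smooth_continuous.
  have NE : Lp_norm 1%:E setT (K e) =
      (\int[@lebesgue_measure R]_y `|(cmod (K e y))%:E|)%E.
    by rewrite /Lp_norm Lnorm1 patch_setT.
  have iK : (@lebesgue_measure R).-integrable setT (fun y => (cmod (K e y))%:E).
    by apply/integrableP; split=> //; rewrite -NE; exact: (nK 0%N).
  split; first by split.
  rewrite NE /L1norm /Rintegral fineK; last exact: integrable_fin_num.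
  by apply: eq_integral => y _; rewrite gee0_abs// lee_fin cmod_ge0.
split=> [e /LK[]//|]; have [m /eqO_exP[C C0 hC]] := mK 0%N.
exists m, C; near=> e.
have e1 : 0 < e <= 1 by near: e; exact: near0_unit.
have : `|net_seminorm 1%:E setT 0 K e| <= C * `|e ^- m| by near: e; exact: hC.
rewrite /net_seminorm /DLp_seminorm big_ord1 [derivn_on _ _ _]/= (LK e e1).2 /=.
case/andP: e1 => e0 _.
by rewrite ger0_norm ?L1norm_ge0// ger0_norm// invr_ge0 exprn_ge0// ltW.
Unshelve. all: by end_near. Qed.

End SmoothClasses.

(** * Almost automorphic and vanishing functions *)

Section AlmostAutomorphic.
Variable R : realType.
Implicit Types (f g h : R -> cplx R) (s : nat -> R).
Local Notation S := (smooth_on setT).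
Local Notation d := (derivn_on setT).

Definition increasing (phi : nat -> nat) := {homo phi : m k / (m < k)%N}.

Definition aa_limit g s (phi : nat -> nat) (gt : R -> cplx R) :=
  (forall x, g (x + s (phi k)) @[k --> \oo] --> gt x) /\
  (forall x, gt (x - s (phi k)) @[k --> \oo] --> g x).

Definition aa_seq g := forall s, exists phi, increasing phi /\ exists gt, aa_limit g s phi gt.

Lemma CaaP g : Caa g <-> continuous g /\ aa_seq g.
Proof. by []. Qed.

Lemma increasing_ge phi : increasing phi -> forall k, (k <= phi k)%N.
Proof. by move=> i; elim=> // k IH; apply: leq_ltn_trans IH (i _ _ (leqnn _)). Qed.

Lemma increasing_cvg phi : increasing phi -> phi k @[k --> \oo] --> \oo.
Proof.
move=> i; apply/cvgnyPge => A; near=> k.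
apply: leq_trans (increasing_ge i k); near: k; exact: nbhs_infty_ge.
Unshelve. all: by end_near. Qed.

Lemma increasing_comp phi psi : increasing phi -> increasing psi -> increasing (phi \o psi).
Proof. by move=> h1 h2 m k mk; apply: h1; exact: h2. Qed.

Lemma aa_limit_sub g s phi psi gt : increasing psi -> aa_limit g s phi gt ->
  aa_limit g s (phi \o psi) gt.
Proof.
move=> ip [h1 h2]; split=> x.
  exact: (cvg_comp _ _ (increasing_cvg ip) (h1 x)).
exact: (cvg_comp _ _ (increasing_cvg ip) (h2 x)).
Qed.

(** The extraction for [g] is made inside the subsequence already extracted for [f]. *)
Lemma aa_seq_pair f g : aa_seq f -> aa_seq g -> forall s,
  exists2 phi, increasing phi &
    exists ft gt, aa_limit f s phi ft /\ aa_limit g s phi gt.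
Proof.
move=> af ag s; have [phi [ip [ft hf]]] := af s.
have [psi [iq [gt hg]]] := ag (s \o phi).
exists (phi \o psi); first exact: increasing_comp.
by exists ft, gt; split; [exact: (aa_limit_sub iq hf)|exact: hg].
Qed.

Lemma cmod_cvg_le (u : nat -> cplx R) l (M : R) :
  u k @[k --> \oo] --> l ->
  (forall eps : R, 0 < eps -> \forall k \near \oo, cmod (u k) <= M + eps) ->
  cmod l <= M.
Proof.
move=> /cplx_cvgP ul uM; apply/ler_addgt0Pr => eps e0.
have e2 : 0 < eps / 2 by rewrite divr_gt0.
near \oo => k.
have h1 : cmod (u k - l) < eps / 2 by near: k; exact: ul.
have h2 : cmod (u k) <= M + eps / 2 by near: k; exact: uM.
rewrite -[l](subKr (u k)); apply: le_trans (cmodB _ _) _.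
by apply: le_trans (lerD h2 (ltW h1)) _; rewrite -addrA -splitr.
Unshelve. all: by end_near. Qed.

Lemma cmod_cvg_bound (u : nat -> cplx R) l (M : R) :
  u k @[k --> \oo] --> l -> (forall k, cmod (u k) <= M) -> cmod l <= M.
Proof.
move=> ul uM; apply: (cmod_cvg_le ul) => eps e0; apply: nearW => k.
by apply: le_trans (uM k) _; rewrite lerDl ltW.
Qed.

(** If [g] is unbounded, pick [s m] where its modulus exceeds [m]: no subsequence of [g (0 + s m)]
    converges. *)
Lemma aa_seq_bounded g : aa_seq g -> exists M, cbounded g M.
Proof.
move=> ag; apply/not_existsP => nb.
have /choice[s hs] : forall m : nat, exists x, m%:R < cmod (g x).
  move=> m; have /existsNP[x /negP] := nb m%:R; rewrite -ltNge => ?; by exists x.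
have [phi [ip [gt [h1 _]]]] := ag s.
have /cplx_cvgP /(_ 1 ltr01) hn := h1 0.
near \oo => k.
have A : cmod (g (0 + s (phi k)) - gt 0) < 1 by near: k.
have B : (cmod (gt 0) + 1 <= k%:R) by near: k; exact: nbhs_infty_ger.
have := hs (phi k); rewrite ltNge => /negP; apply.
rewrite -[g _](subrK (gt 0)) -{1}[s _]add0r; apply: le_trans (cmodD _ _) _.
apply: le_trans (lerD (ltW A) (lexx _)) _; rewrite addrC; apply: le_trans B _.
by rewrite ler_nat increasing_ge.
Unshelve. all: by end_near. Qed.

Lemma aa_seq0 : aa_seq (fun=> 0).
Proof.
move=> s; exists id; split=> //; exists (fun=> 0); split=> x; exact: cvg_cst.
Qed.

Lemma aa_seq_add f g : aa_seq f -> aa_seq g -> aa_seq (fun x => f x + g x).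
Proof.
move=> af ag s; have [phi ip [ft [gt [[f1 f2] [g1 g2]]]]] := aa_seq_pair af ag s.
exists phi; split=> //; exists (fun x => ft x + gt x); split=> x.
  exact: cvgD (f1 x) (g1 x).
exact: cvgD (f2 x) (g2 x).
Qed.

Lemma aa_seq_opp f : aa_seq f -> aa_seq (fun x => - f x).
Proof.
move=> af s; have [phi [ip [ft [f1 f2]]]] := af s.
exists phi; split=> //; exists (fun x => - ft x); split=> x.
  exact: cvgN (f1 x).
exact: cvgN (f2 x).
Qed.

Lemma aa_seq_mul f g : aa_seq f -> aa_seq g -> aa_seq (fun x => f x * g x).
Proof.
move=> af ag s; have [phi ip [ft [gt [[f1 f2] [g1 g2]]]]] := aa_seq_pair af ag s.
exists phi; split=> //; exists (fun x => ft x * gt x); split=> x.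
  exact: cplx_cvgM (f1 x) (g1 x).
exact: cplx_cvgM (f2 x) (g2 x).
Qed.

Lemma aa_seq_translate w f : aa_seq f -> aa_seq (translate w f).
Proof.
move=> af s; have [phi [ip [ft [f1 f2]]]] := af s.
exists phi; split=> //; exists (translate w ft); split=> x.
  rewrite /translate (_ : (fun k => _) = (fun k => f (x + w + s (phi k)))) //.
  by apply/funext => k; rewrite addrAC.
rewrite /translate (_ : (fun k => _) = (fun k => ft (x + w - s (phi k)))) //.
by apply/funext => k; rewrite addrAC.
Qed.

(** Dominated convergence in both directions. The limit [ft] may fail to be continuous; it is
    measurable as a pointwise limit and keeps the bound [M] of [f], which is what the way back
    requires. *)
Lemma aa_seq_convol K f : L1fun K -> continuous f -> aa_seq f -> aa_seq (convol K f).
Proof.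
move=> LK cf af s; have [phi [ip [ft [f1 f2]]]] := af s.
have [M fM] := aa_seq_bounded af.
have mf := cmeasurable_continuous cf.
have mt c g : cmeasurable g -> cmeasurable (fun x => g (x + c)).
  move=> [m1 m2]; have mx : measurable_fun setT (fun y : R => y + c).
    exact: measurable_funD.
  by split; [apply: (measurableT_comp m1 mx) | apply: (measurableT_comp m2 mx)].
have mft : cmeasurable ft.
  exact: (@cmeasurable_cvg _ (fun k x => f (x + s (phi k))) _ (fun k => mt _ _ mf) f1).
have ftM : cbounded ft M.
  by move=> y; apply: cmod_cvg_bound (f1 y) _ => k; exact: fM.
exists phi; split=> //; exists (convol K ft); split=> x.
  rewrite convolE; under eq_fun do rewrite convolE.
  apply: (@cint_cvg _ K (fun k y => f (x + s (phi k) - y)) _ M LK).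
  - by move=> k; exact: cmeasurable_reflect.
  - by move=> k y; exact: fM.
  - move=> y; have := f1 (x - y).
    by under eq_fun do rewrite addrAC.
rewrite convolE; under eq_fun do rewrite convolE.
apply: (@cint_cvg _ K (fun k y => ft (x - s (phi k) - y)) _ M LK).
- by move=> k; exact: cmeasurable_reflect.
- by move=> k y; exact: ftM.
- move=> y; have := f2 (x - y).
  by under eq_fun do rewrite addrAC.
Qed.

(* Limits along integer translates, rather than at +oo, suffice in
   [aa_seq_bound] and come out of dominated convergence for sequences. *)
Definition vanishing h := forall x, h (x + k%:R) @[k --> \oo] --> (0 : cplx R).

Lemma natr_cvgy (x : R) (phi : nat -> nat) : increasing phi ->
  x + (phi k)%:R @[k --> \oo] --> +oo%R.
Proof.
move=> ip; apply/cvgryPge => A; near=> k.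
rewrite -lerBlDl; apply: (@le_trans _ _ k%:R).
  by near: k; exact: nbhs_infty_ger.
by rewrite ler_nat increasing_ge.
Unshelve. all: by end_near. Qed.

Lemma vanishing_cvgy h : h x @[x --> +oo%R] --> (0 : cplx R) -> vanishing h.
Proof. by move=> h0 x; apply: (cvg_comp _ _ (@natr_cvgy x id _) h0). Qed.

Lemma vanishing_add f g : vanishing f -> vanishing g -> vanishing (fun x => f x + g x).
Proof. by move=> vf vg x; rewrite -[0](addr0 0); exact: cvgD (vf x) (vg x). Qed.

Lemma vanishing_opp f : vanishing f -> vanishing (fun x => - f x).
Proof. by move=> vf x; rewrite -oppr0; exact: cvgN (vf x). Qed.

Lemma vanishing_mul f g M : cbounded f M -> vanishing g -> vanishing (fun x => f x * g x).
Proof.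
move=> fM vg x; apply/cplx_cvgP => eps e0.
have M1 : 0 < `|M| + 1 by rewrite ltr_wpDl.
have /cplx_cvgP /(_ (eps / (`|M| + 1))) := vg x; rewrite divr_gt0// => /(_ isT).
apply: filterS => k; rewrite !subr0 cmodM ltr_pdivlMr// mulrC; apply: le_lt_trans.
rewrite ler_wpM2r ?cmod_ge0//; apply: le_trans (fM _) _.
by apply: le_trans (ler_norm _) _; rewrite lerDl.
Qed.

Lemma vanishing_translate w f : vanishing f -> vanishing (translate w f).
Proof.
by move=> vf x; have := vf (x + w); rewrite /translate; under eq_fun do rewrite addrAC.
Qed.

Lemma vanishing_convol K f M : L1fun K -> continuous f -> cbounded f M -> vanishing f ->
  vanishing (convol K f).
Proof.
move=> LK cf fM vf x; under eq_fun do rewrite convolE.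
have := @cint_cvg _ K (fun k y => f (x + k%:R - y)) (fun=> 0) M LK.
rewrite (_ : cint (fun y => K y * 0) = 0); last first.
  rewrite -[RHS](@convol0 R f 0) convolE; congr cint; apply/funext => y.
  by rewrite mulr0 mul0r.
apply.
- by move=> k; apply: cmeasurable_reflect; exact: cmeasurable_continuous.
- by move=> k y; exact: fM.
- by move=> y; have := vf (x - y); under eq_fun do rewrite addrAC.
Qed.

(** The limit [ft] along integer translates sees [f] only near +oo, where [h] has died out, so it
    inherits the bound [M] at every real point; translating back hands this bound to [f]. *)
Lemma aa_seq_bound f h (M : R) : aa_seq f -> vanishing h ->
  (forall x, halfline R x -> cmod (f x + h x) <= M) -> cbounded f M.
Proof.
move=> af vh fhM; have [phi [ip [ft [f1 f2]]]] := af (fun k => k%:R).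
suff ftM y : cmod (ft y) <= M.
  by move=> x; apply: cmod_cvg_bound (f2 x) _ => k; exact: ftM.
apply: (cmod_cvg_le (f1 y)) => eps e0.
have h0 : h (y + (phi k)%:R) @[k --> \oo] --> (0 : cplx R).
  exact: (cvg_comp _ _ (increasing_cvg ip) (vh y)).
near=> k.
rewrite -[f _](addrK (h (y + (phi k)%:R))); apply: le_trans (cmodB _ _) _.
apply: lerD.
  apply: fhM; rewrite /halfline /= in_itv /= andbT; near: k.
  by have /cvgryPge := natr_cvgy y ip; apply.
rewrite -[h _]subr0; apply: ltW; near: k.
by have /cplx_cvgP := h0; apply.
Unshelve. all: by end_near. Qed.

Lemma cmod_remainder_cvg (u v w : nat -> cplx R) (a b c : cplx R) (t N : R) :
  u k @[k --> \oo] --> a -> v k @[k --> \oo] --> b -> w k @[k --> \oo] --> c ->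
  (forall k, cmod (u k - v k - t%:C * w k) <= N) -> cmod (a - b - t%:C * c) <= N.
Proof.
move=> ua vb wc; apply: cmod_cvg_bound.
apply: cvgB; first exact: cvgB ua vb.
by apply: cplx_cvgM wc; exact: cvg_cst.
Qed.

(** Differentiability of [g] is not known beforehand. Since [h] and [h1] die out, translates of [f]
    and [f1] converge to [gt] and [g1t], which therefore satisfy the Taylor bound; translating back
    gives it to [g] and [g1]. *)
Lemma aa_seq_cderiv f f1 f2 g g1 h h1 (M : R) :
  (forall x, cderiv setT f x (f1 x)) -> (forall x, cderiv setT f1 x (f2 x)) ->
  cbounded f2 M -> aa_seq g -> aa_seq g1 -> vanishing h -> vanishing h1 ->
  (forall x, halfline R x -> f x = g x + h x) ->
  (forall x, halfline R x -> f1 x = g1 x + h1 x) ->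
  forall x, cderiv setT g x (g1 x).
Proof.
move=> d1 d2 f2M ag ag1 vh vh1 fgh fgh1 x.
have T := taylor1 d1 d2 f2M.
have [phi ip [gt [g1t [[ga gb] [g1a g1b]]]]] := aa_seq_pair ag ag1 (fun k => k%:R).
have lim F G H Gt : vanishing H -> (forall x, halfline R x -> F x = G x + H x) ->
    (forall x, G (x + (phi k)%:R) @[k --> \oo] --> Gt x) ->
    forall x, F (x + (phi k)%:R) @[k --> \oo] --> (Gt x : cplx R).
  move=> vH FGH Ga y.
  have c : G (y + (phi k)%:R) + H (y + (phi k)%:R) @[k --> \oo] --> (Gt y + 0 : cplx R).
    apply: cvgD; first exact: Ga.
    exact: (cvg_comp _ _ (increasing_cvg ip) (vH y)).
  rewrite addr0 in c; apply: cvg_trans c; apply: near_eq_cvg; near=> k.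
  apply/esym/FGH; rewrite /halfline /= in_itv /= andbT; near: k.
  by have /cvgryPge := natr_cvgy y ip; apply.
have fa := lim _ _ _ _ vh fgh ga.
have f1a := lim _ _ _ _ vh1 fgh1 g1a.
have Tt a b : cmod (gt b - gt a - (b - a)%:C * g1t a) <= M *+ 2 * (b - a) ^+ 2.
  apply: (cmod_remainder_cvg (fa b) (fa a) (f1a a)) => k.
  by have := T (a + (phi k)%:R) (b + (phi k)%:R); rewrite opprD addrACA subrr addr0.
apply: (@cderiv_quadratic _ _ _ _ _ (M *+ 2)) => y _.
apply: (cmod_remainder_cvg (gb y) (gb x) (g1b x)) => k.
have := Tt (x - (phi k)%:R) (y - (phi k)%:R).
by rewrite (_ : y - _ - (x - (phi k)%:R) = y - x)//; ring.
Unshelve. all: by end_near. Qed.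

Lemma Baa_Bsp : @Baa R `<=` Bsp setT.
Proof.
move=> f [sf af]; apply/(BspP (@up_closedT R) sf) => j.
have [_ /aa_seq_bounded[M fM]] := af j; exists M => x _; exact: fM.
Qed.

Lemma Baaa_Bsp : @Baaa R `<=` Bsp setT.
Proof.
move=> f [sf af]; apply/(BspP (@up_closedT R) sf) => j.
have [[_ [M fM]] _] := af j; exists M => x _; exact: fM.
Qed.

Lemma Bplus0_Bsp : @Bplus0 R `<=` Bsp setT.
Proof. by move=> f []. Qed.

(** The definition splits each derivative of [f] on its own, with no relation between the pieces;
    [aa_seq_cderiv] shows that the almost automorphic ones form a jet. The last clause is what makes
    nets of such parts moderate. *)
Lemma Baaa_decomposition f : Baaa f -> exists g, [/\ Baa g,
  Bplus0 (fun x => f x - g x) &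
  forall j (M : R), (forall x, halfline R x -> cmod (d j f x) <= M) -> cbounded (d j g) M].
Proof.
move=> [sf af].
have /choice[gh hgh] : forall j, exists gh : (R -> cplx R) * (R -> cplx R),
    [/\ Caa gh.1, Cplus0 gh.2 & forall x, halfline R x -> d j f x = gh.1 x + gh.2 x].
  by move=> j; have [_ [g [h ?]]] := af j; exists (g, h).
pose g j := (gh j).1; pose h j := (gh j).2.
have ag j : aa_seq (g j) by have [[]] := hgh j.
have vh j : vanishing (h j) by have [_ [_ h0] _] := hgh j; exact: vanishing_cvgy.
have fgh j x : halfline R x -> d j f x = g j x + h j x by have [_ _] := hgh j; apply.
have jg : jet setT (g 0%N) g.
  split=> [x _|j x _]; first exact: erefl.
  have [[_ [M fM]] _] := af j.+2.
  exact: (aa_seq_cderiv (fun y => @smooth_cderiv _ f j y sf)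
    (fun y => @smooth_cderiv _ f j.+1 y sf) fM (ag j) (ag j.+1) (vh j) (vh j.+1)
    (fgh j) (fgh j.+1)).
have sg := jet_smooth (@up_closedT R) jg; have dg := jet_derivnT jg.
exists (g 0%N); split.
- by split=> // j; rewrite dg; have [] := hgh j.
(* [f - g 0] may differ from [h 0] on the negative half-line: its boundedness comes from that of [f]
   and [g], and only its limit at +oo from [h]. *)
- have jw := jetD sf (jet_smooth (@up_closedT R) (jetN sg)).
  have dw j : d j (fun x => f x - g 0%N x) = fun x => d j f x - g j x.
    by rewrite (jet_derivnT jw); apply/funext => x; rewrite (jet_derivnT (jetN sg)) dg.
  have sw := jet_smooth (@up_closedT R) jw.
  split=> [|j]; rewrite ?dw.
    apply/(BspP (@up_closedT R) sw) => j; rewrite dw.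
    have [[_ [M fM]] _] := af j; have [N gN] := aa_seq_bounded (ag j).
    by exists (M + N) => x _; apply: le_trans (cmodB _ _) _; exact: lerD.
  have [_ [_ h0] _] := hgh j; apply: cvg_trans h0; apply: near_eq_cvg; near=> x.
  have hx : halfline R x.
    rewrite /halfline /= in_itv /= andbT; near: x; exact: nbhs_pinfty_ge.
  have e : d j f x - g j x = h j x by rewrite (fgh j x hx) addrAC subrr add0r.
  exact: esym e.
- move=> j M fM; rewrite dg; apply: (aa_seq_bound (ag j) (vh j)) => x hx.
  by rewrite -fgh//; exact: fM.
Unshelve. all: by end_near. Qed.

Lemma Baaa_add g h : Baa g -> Bplus0 h -> Baaa (fun x => g x + h x).
Proof.
move=> Bg Bh; have [sg ag] := Bg; have [[sh bh] vh] := Bh.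
have j := jetD sg sh; split; first exact: (jet_smooth (@up_closedT R) j).
move=> k; rewrite (jet_derivnT j).
have [M gM] := aa_seq_bounded (ag k).2.
have [N hN] := (BspP (@up_closedT R) sh).1 Bh.1 k.
have cg := @continuous_derivn _ g k sg; have ch := @continuous_derivn _ h k sh.
split; last first.
  exists (d k g), (d k h); split=> //; split; last exact: vh.
  by split=> //; exists N => x; exact: hN.
split=> [x|]; first exact: cvgD (cg x) (ch x).
by exists (M + N) => x; apply: le_trans (cmodD _ _) _; apply: lerD; [|exact: hN].
Qed.

End AlmostAutomorphic.

(** * The operator L on classes of nets *)

Section Operator.
Variable R : realType.
Implicit Types (u v K : net R) (D : set R) (P Q T : set (net R)).
Local Notation S := (smooth_on setT).
Local Notation d := (derivn_on setT).

Definition aa_net : set (net R) := [set u | forall e, 0 < e <= 1 -> aa_seq (u e)].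

(** Boundedness is included because convolution preserves vanishing through dominated
    convergence. *)
Definition vanishing_net : set (net R) :=
  [set u | bounded_net setT u /\ forall e, 0 < e <= 1 -> vanishing (u e)].

Lemma aa_net_local : local_class aa_net.
Proof. by move=> u v uv au e e1; rewrite -uv//; exact: au. Qed.

Lemma vanishing_net_local : local_class vanishing_net.
Proof.
move=> u v uv [bu vu]; split; first exact: bounded_net_local bu.
by move=> e e1; rewrite -uv//; exact: vu.
Qed.

Lemma aa_net_bounded : aa_net `<=` bounded_net setT.
Proof.
by move=> u au e e1; have [M uM] := aa_seq_bounded (au e e1); exists M => x _; exact: uM.
Qed.

Lemma in_Baa_net u : in_net (@Baa R) u -> smooth_class aa_net u.
Proof.
move=> Bu; split=> [e e1|j e e1]; first exact: (Bu e e1).1.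
exact: ((Bu e e1).2 j).2.
Qed.

Lemma in_Bplus0_net u : in_net (@Bplus0 R) u -> smooth_class vanishing_net u.
Proof.
move=> Bu; have [su bu] := sub_Bsp_smooth (@Bplus0_Bsp R) Bu.
split=> // j; split; first exact: bu.
by move=> e e1; apply: vanishing_cvgy; exact: ((Bu e e1).2 j).
Qed.

(** [aa_seq_bound] at each order and index, with the constant unchanged; boundedness on R at every
    index comes from almost automorphy itself. *)
Lemma small_of_aa u v : smooth_class aa_net u -> smooth_class vanishing_net v ->
  smooth_class (small (halfline R)) (fun e x => u e x + v e x) ->
  smooth_class (small setT) u.
Proof.
move=> [su au] [sv vv] [_ suv]; split=> // j; split; first exact: aa_net_bounded (au j).
move=> m; have [_ /(_ m)[C hC]] := suv j; exists C; near=> e => x _.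
have e1 : 0 < e <= 1 by near: e; exact: near0_unit.
apply: (aa_seq_bound (au j e e1) ((vv j).2 e e1)) => y hy.
have <- : dnet j (fun e x => u e x + v e x) e y = d j (u e) y + d j (v e) y.
  by rewrite /dnet (jet_derivnT (jetD (su e e1) (sv e e1))).
by move: y hy; near: e.
Unshelve. all: by end_near. Qed.

Lemma class_sum T : T (fun _ _ => 0) -> net_add_closed T ->
  forall n (F : 'I_n -> net R), (forall i, T (F i)) ->
  T (fun e x => \sum_(i < n) F i e x).
Proof.
move=> T0 TD; elim=> [|n IH] F TF.
  rewrite (_ : (fun _ _ => _) = fun _ _ => 0) //.
  by apply/funext => e; apply/funext => x; rewrite big_ord0.
rewrite (_ : (fun _ _ => _) = (fun e x =>
    \sum_(i < n) F (widen_ord (leqnSn n) i) e x + F ord_max e x)).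
  apply: TD (TF _); apply: IH => i; exact: TF.
by apply/funext => e; apply/funext => x; rewrite big_ord_recr.
Qed.

Section LNet.
Variables (n p q : nat) (omega : 'I_q.+1 -> R).
Implicit Types (A : 'I_p.+1 -> 'I_q.+1 -> 'M[net R]_n) (Kr : 'M[net R]_n).
Implicit Types (a b : 'cV[net R]_n).

Definition class_entries (m k : nat) T (B : 'M[net R]_(m, k)) := forall i j, T (B i j).

(** [P] is for the coefficients, [Q] for the unknown, [T] for the result. The instances are: all
    bounded, all almost automorphic, bounded times vanishing, and the two products of a moderate and
    a negligible net. *)
Lemma L_net_class P Q T A Kr a : local_class Q -> local_class T -> net_add_closed T ->
  T (fun _ _ => 0) ->
  (forall w u, Q u -> Q (fun e => translate w (u e))) ->
  (forall u v, P u -> Q v -> T (fun e x => u e x * v e x)) ->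
  (forall i j, class_entries (smooth_class P) (A i j)) ->
  class_entries (smooth_class Q) a ->
  (forall r l, smooth_class T (fun e => convol (Kr r l e) (a l ord0 e))) ->
  forall r, smooth_class T (L_net omega A Kr a r).
Proof.
move=> lQ lT aT T0 tQ PQ PA Qa TK r.
have sT0 := smooth_class0 T0; have saT := smooth_class_add lT aT.
apply: (class_sum sT0 saT) => l.
apply: (saT (fun e x => _) (fun e => convol (Kr r l e) (a l ord0 e))); last exact: TK.
apply: (class_sum sT0 saT) => i; apply: (class_sum sT0 saT) => j.
apply: (smooth_class_mul lT aT PQ) (PA i j r l) _.
apply: (smooth_class_derivn i).
exact: smooth_class_translate lQ (tQ _) _ (Qa l ord0).
Qed.

Lemma L_net_bounded A Kr a :
  (forall i j, class_entries (smooth_class (bounded_net setT)) (A i j)) ->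
  (forall r l, L1_net (Kr r l)) -> class_entries (smooth_class (bounded_net setT)) a ->
  forall r, smooth_class (bounded_net setT) (L_net omega A Kr a r).
Proof.
move=> bA LK ba.
have lb := @bounded_net_local R setT.
apply: (L_net_class lb lb (@bounded_net_add R setT) (@bounded_net0 R setT)
  (@bounded_net_translate R) (@bounded_net_mul R setT) bA ba) => r l.
apply: (smooth_class_convol lb (LK r l).1 _ _ (ba l ord0)) => // u.
exact: bounded_net_convol (LK r l).1.
Qed.

Lemma L_net_aa A Kr a : (forall i j, class_entries (smooth_class aa_net) (A i j)) ->
  (forall r l, L1_net (Kr r l)) -> class_entries (smooth_class aa_net) a ->
  forall r, smooth_class aa_net (L_net omega A Kr a r).
Proof.
move=> aA LK aa.
apply: (L_net_class aa_net_local aa_net_local _ _ _ _ aA aa).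
- by move=> u v au av e e1; apply: aa_seq_add; [exact: au|exact: av].
- by move=> e _; exact: aa_seq0.
- by move=> w u au e e1; apply: aa_seq_translate; exact: au.
- by move=> u v au av e e1; apply: aa_seq_mul; [exact: au|exact: av].
move=> r l.
apply: (smooth_class_convol aa_net_local (LK r l).1 aa_net_bounded _ (aa l ord0)) => u su au e e1.
apply: aa_seq_convol ((LK r l).1 e e1) _ (au e e1).
exact: smooth_continuous (su e e1).
Qed.

Lemma L_net_vanishing A Kr a :
  (forall i j, class_entries (smooth_class (bounded_net setT)) (A i j)) ->
  (forall r l, L1_net (Kr r l)) -> class_entries (smooth_class vanishing_net) a ->
  forall r, smooth_class vanishing_net (L_net omega A Kr a r).
Proof.
move=> bA LK va.
apply: (L_net_class vanishing_net_local vanishing_net_local _ _ _ _ bA va).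
- move=> u v [bu vu] [bv vv]; split; first exact: bounded_net_add.
  by move=> e e1; apply: vanishing_add; [exact: vu|exact: vv].
- split; first exact: bounded_net0.
  by move=> e _ x; exact: cvg_cst.
- move=> w u [bu vu]; split; first exact: bounded_net_translate.
  by move=> e e1; apply: vanishing_translate; exact: vu.
- move=> u v bu [bv vv]; split; first exact: bounded_net_mul.
  move=> e e1; have [M uM] := bu e e1.
  exact: (vanishing_mul (fun x => uM x I) (vv e e1)).
move=> r l.
apply: (smooth_class_convol vanishing_net_local (LK r l).1 _ _ (va l ord0)) => u; first by case.
move=> su [bu vu]; split; first exact: bounded_net_convol (LK r l).1 su bu.
move=> e e1; have [M uM] := bu e e1.
exact: (vanishing_convol ((LK r l).1 e e1) (smooth_continuous (su e e1))
  (fun x => uM x I) (vu e e1)).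
Qed.

Definition add_mx a b : 'cV[net R]_n :=
  \matrix_(i, j) (fun e x => a i j e x + b i j e x).

Definition sub_mx (m : nat) (B C : 'M[net R]_(n, m)) : 'M[net R]_(n, m) :=
  \matrix_(i, j) (fun e x => B i j e x - C i j e x).

(** Additivity of the convolution integrals needs integrability, which boundedness of [a] and [b] at
    an index of ]0, 1] provides. *)
Lemma L_net_add A Kr a b e x : 0 < e <= 1 -> (forall r l, L1_net (Kr r l)) ->
  class_entries (smooth_class (bounded_net setT)) a ->
  class_entries (smooth_class (bounded_net setT)) b -> forall r,
  L_net omega A Kr (add_mx a b) r e x =
    L_net omega A Kr a r e x + L_net omega A Kr b r e x.
Proof.
move=> e1 LK ba bb r; rewrite /L_net -big_split /=; apply: eq_bigr => l _.
have [[sa Ba] [sb Bb]] := (ba l ord0, bb l ord0).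
have [M aM] := Ba 0%N e e1; have [N bN] := Bb 0%N e e1.
rewrite mxE (convolD ((LK r l).1 e e1) (cmeasurable_smooth (sa e e1)) (fun y => aM y I)
  (cmeasurable_smooth (sb e e1)) (fun y => bN y I)) addrACA; congr (_ + _).
rewrite -big_split; apply: eq_bigr => i _; rewrite -big_split; apply: eq_bigr => j _ /=.
rewrite -mulrDr; congr (_ * _).
have ta := jet_smooth (@up_closedT R) (jet_translate (omega j) (sa e e1)).
have tb := jet_smooth (@up_closedT R) (jet_translate (omega j) (sb e e1)).
by have := jet_derivnT (jetD ta tb) i => /(congr1 (fun f => f x)).
Qed.

(** The kernel being common, the difference is again an [L_net], with zero kernel, and so falls
    under [L_net_class]. *)
Lemma L_net_sub A A' Kr a r e x :
  L_net omega A Kr a r e x = L_net omega A' Kr a r e x +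
    L_net omega (fun i j => sub_mx (A i j) (A' i j)) (\matrix_(_, _) fun _ _ => 0) a r e x.
Proof.
rewrite /L_net -big_split /=; apply: eq_bigr => l _.
rewrite mxE convol0 addr0 addrAC; congr (_ + _).
rewrite -big_split; apply: eq_bigr => i _; rewrite -big_split; apply: eq_bigr => j _ /=.
by rewrite mxE -mulrDl addrC subrK.
Qed.

(** The difference is [L] with coefficients [A] applied to [a - a'], plus [L] with coefficients
    [A - A'] and zero kernel applied to [a']: each pairs moderate data with negligible data. *)
Lemma L_net_small A A' Kr a a' :
  (forall i j, class_entries (smooth_class (tempered setT)) (A i j)) ->
  (forall i j, class_entries (smooth_class (small setT)) (sub_mx (A i j) (A' i j))) ->
  (forall r l, L1_net (Kr r l)) ->
  class_entries (smooth_class (tempered setT)) a ->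
  class_entries (smooth_class (tempered setT)) a' ->
  class_entries (smooth_class (small setT)) (sub_mx a a') -> forall r,
  smooth_class (small setT)
    (fun e x => L_net omega A Kr a r e x - L_net omega A' Kr a' r e x).
Proof.
move=> tA sA LK ta ta' sa r.
have tb T : T = tempered setT -> T `<=` bounded_net setT by move=> -> u [].
have B := smooth_classS (tb _ erefl).
have ls := @small_local R setT; have lt := @tempered_local R setT.
have s1 : smooth_class (small setT) (L_net omega (fun i j => sub_mx (A i j) (A' i j))
    (\matrix_(_, _) fun _ _ => 0) a' r).
  apply: (L_net_class lt ls (@small_add R setT) (@small0 R setT)
    (@tempered_translate R) (@small_mul_tempered R setT) sA ta') => r' l.
  apply: (smooth_class_local ls) (smooth_class0 (@small0 R setT)) => e _.
  by apply/funext => x; rewrite mxE convol0.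
have s2 : smooth_class (small setT) (L_net omega A Kr (sub_mx a a') r).
  apply: (L_net_class ls ls (@small_add R setT) (@small0 R setT)
    (@small_translate R) (@tempered_mul_small R setT) tA sa) => r' l.
  apply: (smooth_class_convol ls (LK r' l).1 _ _ (sa l ord0)) => u; first by case.
  exact: small_convol (LK r' l).
apply: (smooth_class_local ls) (smooth_class_add ls (@small_add R setT) s1 s2) => e e1.
apply/funext => x.
have -> : L_net omega A Kr a r e x = L_net omega A Kr (add_mx a' (sub_mx a a')) r e x.
  congr (L_net omega A Kr _ r e x); apply/matrixP => i j; rewrite !mxE.
  by apply/funext => e'; apply/funext => y; rewrite addrC subrK.
rewrite L_net_add//.
- by rewrite (L_net_sub A A' Kr a'); ring.
- by move=> i j; apply: B; exact: ta'.
- by move=> i j; apply: B; exact: (smooth_classS (@small_tempered R setT)).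
Qed.

End LNet.
End Operator.

(** * Representatives of generalized functions *)

Section Representatives.
Variable R : realType.
Implicit Types (u v : net R) (U : GB R) (X : set (R -> cplx R)).

Lemma smooth_class_subrr T u : local_class T -> T (fun _ _ => 0) ->
  smooth_class T (fun e x => u e x - u e x).
Proof.
move=> lT T0; rewrite (_ : (fun e x => _) = fun _ _ => 0); first exact: smooth_class0.
by apply/funext => e; apply/funext => x /=; rewrite subrr.
Qed.

Lemma in_net_Bsp u : smooth_class (bounded_net setT) u -> in_net (Bsp setT) u.
Proof.
move=> [su bu] e e1; apply/(BspP (@up_closedT R) (su e e1)) => j; exact: bu.
Qed.

Lemma tempered_bounded D u : smooth_class (tempered D) u -> smooth_class (bounded_net D) u.
Proof. by apply: smooth_classS => v []. Qed.

Lemma small_bounded D u : smooth_class (small D) u -> smooth_class (bounded_net D) u.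
Proof. by apply: smooth_classS => v []. Qed.

Lemma net_class_BspP u v : net_class +oo setT (Bsp setT) u v <->
  smooth_class (tempered setT) v /\ smooth_class (small setT) (fun e x => v e x - u e x).
Proof.
have XB := @subset_refl _ (@Bsp R setT).
split=> [[/(moderate_netP _ XB)[_ tv] /(negligible_netP _ XB)[_ suv]]|[tv suv]]; first by [].
split; first by apply/(moderate_netP _ XB); split=> //; exact/in_net_Bsp/tempered_bounded.
by apply/(negligible_netP _ XB); split=> //; exact/in_net_Bsp/small_bounded.
Qed.

Lemma reps_tempered U u : reps U u -> smooth_class (tempered setT) u.
Proof. by have [w _ ->] := repsP U => /net_class_BspP[]. Qed.

Lemma smooth_class_smallB D u v : smooth_class (small D) u -> smooth_class (small D) v ->
  smooth_class (small D) (fun e x => u e x - v e x).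
Proof.
move=> su sv; apply: (smooth_class_add (@small_local R D) (@small_add R D) su).
exact: smooth_class_opp (@small_local R D) (@small_opp R D) _ sv.
Qed.

Lemma smooth_class_temperedB D u v : smooth_class (tempered D) u ->
  smooth_class (tempered D) v -> smooth_class (tempered D) (fun e x => u e x - v e x).
Proof.
move=> su sv; apply: (smooth_class_add (@tempered_local R D) (@tempered_add R D) su).
exact: smooth_class_opp (@tempered_local R D) (@tempered_opp R D) _ sv.
Qed.

Lemma reps_sub U u v : reps U u -> reps U v ->
  smooth_class (small setT) (fun e x => u e x - v e x).
Proof.
have [w _ ->] := repsP U => /net_class_BspP[_ su] /net_class_BspP[_ sv].
have := smooth_class_smallB su sv; congr (smooth_class _ _).
by apply/funext => e; apply/funext => x; ring.
Qed.

Lemma reps_stable U u v : reps U u -> smooth_class (tempered setT) v ->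
  smooth_class (small setT) (fun e x => v e x - u e x) -> reps U v.
Proof.
have [w _ ->] := repsP U => /net_class_BspP[_ su] tv sv; apply/net_class_BspP; split=> //.
have := smooth_class_add (@small_local R setT) (@small_add R setT) sv su.
by congr (smooth_class _ _); apply/funext => e; apply/funext => x; ring.
Qed.

Lemma net_class_refl X u : X `<=` Bsp setT -> X (fun=> 0) ->
  moderate_net +oo setT X u -> net_class +oo setT X u u.
Proof.
move=> XB X0 mu; split=> //; apply/(negligible_netP _ XB); split.
  move=> e _; rewrite (_ : (_ \- _) = fun=> 0)//.
  by apply/funext => x /=; rewrite subrr.
exact: smooth_class_subrr (@small_local R setT) (@small0 R setT).
Qed.

Lemma Baa0 : Baa (fun _ : R => 0).
Proof.
split=> [|j]; first exact: jet_smooth (jet0 R).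
rewrite (jet_derivnT (jet0 R)); apply/CaaP; split; last exact: aa_seq0.
by move=> x; exact: cvg_cst.
Qed.

Lemma Bplus00 : Bplus0 (fun _ : R => 0).
Proof.
split=> [|j]; last by rewrite (jet_derivnT (jet0 R)); exact: cvg_cst.
apply/(BspP (@up_closedT R) (jet_smooth (@up_closedT R) (jet0 R))) => j.
by rewrite (jet_derivnT (jet0 R)); exists 0 => x _; rewrite cmod0.
Qed.

Lemma Baaa0 : Baaa (fun _ : R => 0).
Proof.
have := Baaa_add Baa0 Bplus00.
by congr Baaa; apply/funext => x; rewrite addr0.
Qed.

Lemma reps_nonempty U : exists u, reps U u.
Proof.
have [w mw ->] := repsP U; exists w; apply: net_class_refl => //.
exact: Bplus0_Bsp Bplus00.
Qed.

Lemma viewed_reps X U : X `<=` Bsp setT -> X (fun=> 0) -> viewed_in_GB X U ->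
  exists u, reps U u /\ in_net X u.
Proof.
move=> XB X0 [V VU]; have [w mw eV] := repsP V; exists w; split; last by case: mw.
by apply: VU; rewrite eV; exact: net_class_refl.
Qed.

(** The class modulo negligible nets of [X] lies inside the class modulo negligible nets of
    [Bsp setT], the growth conditions being the same. *)
Lemma viewed_class X u : X `<=` Bsp setT -> X (fun=> 0) -> in_net X u ->
  smooth_class (tempered setT) u -> exists U, viewed_in_GB X U /\ reps U u.
Proof.
move=> XB X0 Xu tu.
have mX : moderate_net +oo setT X u by apply/moderate_netP.
have BB := @subset_refl _ (@Bsp R setT).
have mB : moderate_net +oo setT (Bsp setT) u.
  by apply/moderate_netP => //; split=> //; exact/in_net_Bsp/tempered_bounded.
exists (Colombeau (ex_intro2 _ _ u mB erefl)); split; last first.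
  by apply: net_class_refl => //; exact: XB.
exists (Colombeau (ex_intro2 _ _ u mX erefl)) => v /= [mv nv].
apply/net_class_BspP; split; first by have /(moderate_netP _ XB)[] := mv.
by have /(negligible_netP _ XB)[] := nv.
Qed.

Lemma reps_L1_net (K : GL1 R) k : reps K k -> L1_net k.
Proof. by have [w _ ->] := repsP K => -[/moderate_L1_net]. Qed.

Lemma reps_mx_exists m k (U : 'M[GB R]_(m, k)) :
  exists b : 'M[net R]_(m, k), reps_mx U b.
Proof.
have /choice[u hu] : forall ij : 'I_m * 'I_k, exists u, reps (U ij.1 ij.2) u.
  by move=> ij; exact: reps_nonempty.
by exists (\matrix_(i, j) u (i, j)) => i j; rewrite mxE; exact: hu (i, j).
Qed.

Lemma viewed_mx_reps X m k (U : 'M[GB R]_(m, k)) : X `<=` Bsp setT -> X (fun=> 0) ->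
  entries_in (viewed_in_GB X) U ->
  exists b : 'M[net R]_(m, k), reps_mx U b /\ forall i j, in_net X (b i j).
Proof.
move=> XB X0 XU.
have /choice[u hu] : forall ij : 'I_m * 'I_k, exists u, reps (U ij.1 ij.2) u /\ in_net X u.
  by move=> ij; exact: viewed_reps XB X0 (XU _ _).
exists (\matrix_(i, j) u (i, j)); split=> i j; rewrite mxE; first exact: (hu (i, j)).1.
exact: (hu (i, j)).2.
Qed.

Lemma viewed_mx_class X m k (u : 'M[net R]_(m, k)) : X `<=` Bsp setT -> X (fun=> 0) ->
  (forall i j, in_net X (u i j)) -> class_entries (smooth_class (tempered setT)) u ->
  exists W : 'M[GB R]_(m, k), entries_in (viewed_in_GB X) W /\ reps_mx W u.
Proof.
move=> XB X0 Xu tu.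
have /choice[U hU] : forall ij : 'I_m * 'I_k, exists U : GB R,
    viewed_in_GB X U /\ reps U (u ij.1 ij.2).
  by move=> ij; exact: viewed_class.
exists (\matrix_(i, j) U (i, j)); split=> i j; rewrite mxE; first exact: (hU (i, j)).1.
exact: (hU (i, j)).2.
Qed.

Lemma reps_mx_tempered m k (U : 'M[GB R]_(m, k)) (b : 'M[net R]_(m, k)) :
  reps_mx U b -> class_entries (smooth_class (tempered setT)) b.
Proof. by move=> ru i j; exact: reps_tempered (ru i j). Qed.

(** The splitting is chosen index by index, with no uniformity; [v] is moderate because each of its
    derivatives obeys the very bound of the corresponding derivative of [u]. *)
Lemma Baaa_net_decomposition u : in_net (@Baaa R) u -> smooth_class (tempered setT) u ->
  exists v, [/\ in_net (@Baa R) v, smooth_class (tempered setT) v &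
    in_net (@Bplus0 R) (fun e x => u e x - v e x)].
Proof.
move=> Bu [su tu].
have /choice[v hv] : forall e : R, exists g, 0 < e <= 1 -> [/\ Baa g,
    Bplus0 (fun x => u e x - g x) & forall j (M : R),
    (forall x, halfline R x -> cmod (derivn_on setT j (u e) x) <= M) ->
    cbounded (derivn_on setT j g) M].
  move=> e; have [e1|ne1] := pselect (0 < e <= 1); last by exists (fun=> 0).
  by have [g hg] := Baaa_decomposition (Bu e e1); exists g.
have Bv : in_net (@Baa R) v by move=> e /hv[].
exists v; split; [exact: Bv| |by move=> e /hv[_ h _]; exact: h].
have [sv bv] := sub_Bsp_smooth (@Baa_Bsp R) Bv.
split=> // j; split; first exact: bv.
have [_ [m [C hC]]] := tu j; exists m, C; near=> e => x _.
have e1 : 0 < e <= 1 by near: e; exact: near0_unit.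
have [_ _ ve] := hv e e1; apply: ve => y _.
suff : forall y, setT y -> cmod (dnet j u e y) <= C * e ^- m by apply.
by near: e.
Unshelve. all: by end_near. Qed.

End Representatives.

(** * Residuals and generalized solutions *)

Section Equations.
Variable R : realType.
Variables (n p q : nat) (omega : 'I_q.+1 -> R).
Implicit Types (D : set R) (A : 'I_p.+1 -> 'I_q.+1 -> 'M[net R]_n).
Implicit Types (Kr : 'M[net R]_n) (a b f g h : 'cV[net R]_n).

Definition residual A Kr a f (r : 'I_n) : net R :=
  fun e x => L_net omega A Kr a r e x - f r ord0 e x.

Lemma residual_smooth A Kr a f r :
  (forall i j, class_entries (smooth_class (tempered setT)) (A i j)) ->
  (forall i l, L1_net (Kr i l)) -> class_entries (smooth_class (tempered setT)) a ->
  class_entries (smooth_class (tempered setT)) f ->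
  smooth_net (residual A Kr a f r).
Proof.
move=> tA LK ta tf e e1.
have tL := L_net_bounded omega (fun i j r l => tempered_bounded (tA i j r l)) LK
  (fun i j => tempered_bounded (ta i j)) r.
exact: (jet_smooth (@up_closedT R) (jetD (tL.1 e e1)
  (jet_smooth (@up_closedT R) (jetN ((tf r ord0).1 e e1))))).
Qed.

(** By linearity of [L] the combination equals [-(f - (g + h))], so adding solutions reduces to the
    decomposition of the right-hand side. *)
Lemma residual_add A Kr a b f g h r D :
  (forall i l, L1_net (Kr i l)) ->
  class_entries (smooth_class (tempered setT)) a ->
  class_entries (smooth_class (tempered setT)) b ->
  smooth_class (small D) (fun e x => f r ord0 e x - (g r ord0 e x + h r ord0 e x)) ->
  smooth_class (small D) (fun e x => residual A Kr (add_mx a b) f r e x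
    - (residual A Kr a g r e x + residual A Kr b h r e x)).
Proof.
move=> LK ta tb sf.
have := smooth_class_opp (@small_local R D) (@small_opp R D) sf.
apply: (smooth_class_local (@small_local R D)) => e e1; apply/funext => x.
rewrite /residual (L_net_add omega A (Kr := Kr) x e1 LK (fun i j => tempered_bounded (ta i j))
  (fun i j => tempered_bounded (tb i j))).
by ring.
Qed.

Lemma solution_small D A Kr (AA : 'I_p.+1 -> 'I_q.+1 -> 'M[GB R]_n) (K : 'M[GL1 R]_n)
    (u f : 'cV[GB R]_n) ur fr r : up_closed D ->
  generalized_solution D omega AA K u f -> (forall i j, reps_mx (AA i j) (A i j)) ->
  reps_mx K Kr -> reps_mx u ur -> reps_mx f fr ->
  smooth_class (small D) (residual A Kr ur fr r).
Proof.
move=> uD Su rA rK ru rf.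
have sr : smooth_net (residual A Kr ur fr r).
  apply: residual_smooth; [|move=> i l|exact: reps_mx_tempered ru|exact: reps_mx_tempered rf].
    by move=> i j; exact: reps_mx_tempered (rA i j).
  exact: reps_L1_net (rK i l).
by apply/(negligible_onP uD sr); exact: Su.
Qed.

Lemma small_solution D (AA : 'I_p.+1 -> 'I_q.+1 -> 'M[GB R]_n) (K : 'M[GL1 R]_n)
    (u f : 'cV[GB R]_n) : up_closed D ->
  (forall ur A Kr fr, (forall i j, reps_mx (AA i j) (A i j)) ->
    (forall i l, L1_net (Kr i l)) ->
    reps_mx K Kr -> reps_mx u ur -> reps_mx f fr -> forall r,
    smooth_class (small D) (residual A Kr ur fr r)) ->
  generalized_solution D omega AA K u f.
Proof.
move=> uD h ur A Kr fr ru rA rK rf r.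
have LK i l : L1_net (Kr i l).
  exact: reps_L1_net (rK i l).
have sr : smooth_net (residual A Kr ur fr r).
  apply: residual_smooth; [|exact: LK|exact: reps_mx_tempered ru|exact: reps_mx_tempered rf].
  by move=> i j; exact: reps_mx_tempered (rA i j).
by apply/(negligible_onP uD sr); exact: h.
Qed.

End Equations.

Theorem theorem5 (R : realType) (n p q : nat) (n_ge1 : (1 <= n)%N)
    (omega : 'I_q.+1 -> R) (omega_ge0 : forall j, 0 <= omega j)
    (A : 'I_p.+1 -> 'I_q.+1 -> 'M[GB R]_n)
    (A_aa : forall i j, entries_in (Gaa R) (A i j))
    (K : 'M[GL1 R]_n)
    (f f_aa f_cor : 'cV[GB R]_n)
    (f_in : entries_in (Gaaa R) f)
    (f_aa_in : entries_in (Gaa R) f_aa)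
    (f_cor_in : entries_in (Gplus0 R) f_cor)
    (f_dec : sum_on (halfline R) f f_aa f_cor) :
  (exists u : 'cV[GB R]_n,
     entries_in (Gaaa R) u /\
     generalized_solution (halfline R) omega A K u f)
  <->
  (exists v w : 'cV[GB R]_n,
     [/\ entries_in (Gaa R) v, entries_in (Gplus0 R) w,
         generalized_solution setT omega A K v f_aa &
         generalized_solution (halfline R) omega A K w f_cor]).
Proof.
have uJ := @up_closed_halfline R; have uT := @up_closedT R.
have sJ : halfline R `<=` setT by [].
have lJ := @small_local R (halfline R); have aJ := @small_add R (halfline R).
have smD := smooth_class_add lJ aJ.
(* Coefficients that are almost automorphic at each index are fixed here, other representatives of
   [A] having no reason to be so. *)
have [A0 [rA0 BA0]] : exists A0 : 'I_p.+1 -> 'I_q.+1 -> 'M[net R]_n,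
    (forall i j, reps_mx (A i j) (A0 i j)) /\
    (forall i j r l, in_net (@Baa R) (A0 i j r l)).
  have /choice[a ha] : forall ij : 'I_p.+1 * 'I_q.+1, exists B : 'M[net R]_n,
      reps_mx (A ij.1 ij.2) B /\ forall r l, in_net (@Baa R) (B r l).
    by move=> ij; apply: viewed_mx_reps (A_aa _ _); [exact: Baa_Bsp|exact: Baa0].
  exists (fun i j => a (i, j)); split=> i j; first exact: (ha (i, j)).1.
  exact: (ha (i, j)).2.
have [fa0 [rfa0 Bfa0]] := viewed_mx_reps (@Baa_Bsp R) (@Baa0 R) f_aa_in.
have [fc0 [rfc0 Bfc0]] := viewed_mx_reps (@Bplus0_Bsp R) (@Bplus00 R) f_cor_in.
have [fr0 rfr0] := reps_mx_exists f.
have fdec fr fa fc : reps_mx f fr -> reps_mx f_aa fa -> reps_mx f_cor fc -> forall r,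
    smooth_class (small (halfline R))
      (fun e x => fr r ord0 e x - (fa r ord0 e x + fc r ord0 e x)).
  move=> rf ra rc r; have tf := reps_mx_tempered rf r ord0.
  have ta := reps_mx_tempered ra r ord0; have tc := reps_mx_tempered rc r ord0.
  have td := smooth_class_temperedB tf
    (smooth_class_add (@tempered_local R setT) (@tempered_add R setT) ta tc).
  exact: ((negligible_onP uJ td.1).1 (f_dec fr fa fc rf ra rc r)).
split=> [[u [Hu Su]]|[v [w [Hv Hw Sv Sw]]]].
- have [u0 [ru0 Bu0]] := viewed_mx_reps (@Baaa_Bsp R) (@Baaa0 R) Hu.
  have tu0 := reps_mx_tempered ru0.
  have [v0 [Bv0 tv0 Bw0]] : exists v0 : 'cV[net R]_n, [/\
      forall i j, in_net (@Baa R) (v0 i j),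
      class_entries (smooth_class (tempered setT)) v0 &
      forall i j, in_net (@Bplus0 R) (sub_mx u0 v0 i j)].
    have /choice[v hv] : forall ij : 'I_n * 'I_1, exists v, [/\ in_net (@Baa R) v,
        smooth_class (tempered setT) v &
        in_net (@Bplus0 R) (fun e x => u0 ij.1 ij.2 e x - v e x)].
      by move=> ij; exact: Baaa_net_decomposition (Bu0 _ _) (tu0 _ _).
    exists (\matrix_(i, j) v (i, j)).
    by split=> i j; rewrite !mxE; have [] := hv (i, j).
  pose w0 := sub_mx u0 v0.
  have tw0 : class_entries (smooth_class (tempered setT)) w0.
    by move=> i j; rewrite mxE; exact: smooth_class_temperedB.
  have u0E : u0 = add_mx v0 w0.
    apply/matrixP => i j; rewrite !mxE; apply/funext => e; apply/funext => x.
    by rewrite addrC subrK.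
  have [v [Hv rv]] := viewed_mx_class (@Baa_Bsp R) (@Baa0 R) Bv0 tv0.
  have [w [Hw rw]] := viewed_mx_class (@Bplus0_Bsp R) (@Bplus00 R) Bw0 tw0.
  (* [A0], [v0] and [fa0] are fixed but the kernel is arbitrary, which spares a change of kernel
     afterwards. *)
  have core (Kr : 'M[net R]_n) r : (forall i l, L1_net (Kr i l)) -> reps_mx K Kr ->
      smooth_class (small setT) (residual omega A0 Kr v0 fa0 r).
    move=> LK rK.
    have bA i j : class_entries (smooth_class (bounded_net setT)) (A0 i j).
      by move=> r' l; exact: tempered_bounded (reps_mx_tempered (rA0 i j) r' l).
    apply: (@small_of_aa R _ (residual omega A0 Kr w0 fc0 r)).
    + have aL := L_net_aa omega (fun i j r l => in_Baa_net (BA0 i j r l)) LK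
        (fun i j => in_Baa_net (Bv0 i j)) r.
      apply: (smooth_class_add (@aa_net_local R) _ aL).
        by move=> a b aa ab e e1; apply: aa_seq_add; [exact: aa|exact: ab].
      apply: (smooth_class_opp (@aa_net_local R) _ (in_Baa_net (Bfa0 r ord0))).
      by move=> a aa e e1; apply: aa_seq_opp; exact: aa.
    + have vL := L_net_vanishing omega bA LK (fun i j => in_Bplus0_net (Bw0 i j)) r.
      apply: (smooth_class_add (@vanishing_net_local R) _ vL).
        move=> a b [ba va] [bb vb]; split; first exact: bounded_net_add.
        by move=> e e1; apply: vanishing_add; [exact: va|exact: vb].
      apply: (smooth_class_opp (@vanishing_net_local R) _ (in_Bplus0_net (Bfc0 r ord0))).
      move=> a [ba va]; split; first exact: bounded_net_opp.
      by move=> e e1; apply: vanishing_opp; exact: va.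
    have h1 := solution_small r uJ Su rA0 rK ru0 rfr0.
    have h2 := residual_add omega A0 LK tv0 tw0 (fdec _ _ _ rfr0 rfa0 rfc0 r).
    have := smooth_class_smallB h1 h2; congr (smooth_class _ _).
    by apply/funext => e; apply/funext => x; rewrite u0E; ring.
  (* Passage to arbitrary representatives of [A], [v] and [f_aa], each of which alters the residual
     by a negligible net. *)
  have solv (vr : 'cV[net R]_n) (Ar : 'I_p.+1 -> 'I_q.+1 -> 'M[net R]_n)
      (Kr : 'M[net R]_n) (far : 'cV[net R]_n) : (forall i j, reps_mx (A i j) (Ar i j)) ->
      (forall i l, L1_net (Kr i l)) -> reps_mx K Kr -> reps_mx v vr ->
      reps_mx f_aa far -> forall r,
      smooth_class (small setT) (residual omega Ar Kr vr far r).
    move=> rA LK rK rvr rfa r.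
    have h1 := core Kr r LK rK.
    have h2 : smooth_class (small setT)
        (fun e x => L_net omega Ar Kr vr r e x - L_net omega A0 Kr v0 r e x).
      apply: (fun H1 H2 H3 H4 => L_net_small omega H1 H2 LK H3 tv0 H4 r).
      + by move=> i j; exact: reps_mx_tempered.
      + by move=> i j r' l; rewrite mxE; exact: reps_sub (rA i j r' l) (rA0 i j r' l).
      + exact: reps_mx_tempered.
      + by move=> i j; rewrite mxE; exact: reps_sub (rvr i j) (rv i j).
    have h3 := reps_sub (rfa r ord0) (rfa0 r ord0).
    have := smooth_class_smallB (smooth_class_add (@small_local R setT)
      (@small_add R setT) h1 h2) h3; congr (smooth_class _ _).
    by apply/funext => e; apply/funext => x; rewrite /residual; ring.
  exists v, w; split; [exact: Hv|exact: Hw|exact: (small_solution uT solv)|].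
  apply: (small_solution uJ) => wr Ar Kr fcr rA LK rK rwr rfc r.
  have twr := reps_mx_tempered rwr.
  (* For [w] no new estimate is made: [v0 + wr] represents [u] for every representative [wr] of [w],
     and subtracting the equation of [v0], restricted to the half-line, leaves that of [wr]. *)
  have rur : reps_mx u (add_mx v0 wr).
    move=> i j; rewrite mxE; apply: (reps_stable (ru0 i j)).
      exact: (smooth_class_add (@tempered_local R setT) (@tempered_add R setT)).
    have := reps_sub (rwr i j) (rw i j); congr (smooth_class _ _).
    by apply/funext => e; apply/funext => x; rewrite /w0 mxE; ring.
  have h1 := solution_small r uJ Su rA rK rur rfr0.
  have h2 := smooth_classS (fun u => small_sub sJ) (solv v0 Ar Kr fa0 rA LK rK rv rfa0 r).
  have h3 := residual_add omega Ar LK tv0 twr (fdec _ _ _ rfr0 rfa0 rfc r).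
  have := smooth_class_smallB (smooth_class_smallB h1 h2) h3; congr (smooth_class _ _).
  by apply/funext => e; apply/funext => x; ring.
- have [v0 [rv0 Bv0]] := viewed_mx_reps (@Baa_Bsp R) (@Baa0 R) Hv.
  have [w0 [rw0 Bw0]] := viewed_mx_reps (@Bplus0_Bsp R) (@Bplus00 R) Hw.
  have tv0 := reps_mx_tempered rv0; have tw0 := reps_mx_tempered rw0.
  have [u [Hu ru]] : exists u : 'cV[GB R]_n, entries_in (Gaaa R) u /\
      reps_mx u (add_mx v0 w0).
    apply: viewed_mx_class; [exact: Baaa_Bsp|exact: Baaa0| |].
      by move=> i j e e1; rewrite mxE; apply: Baaa_add; [exact: Bv0|exact: Bw0].
    move=> i j; rewrite mxE.
    exact: (smooth_class_add (@tempered_local R setT) (@tempered_add R setT)).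
  exists u; split; first exact: Hu.
  apply: (small_solution uJ) => ur Ar Kr fr rA LK rK rur rf r.
  have tur := reps_mx_tempered rur.
  (* Taking [ur - w0] as representative of [v] makes [ur] exactly a sum of representatives of [v]
     and [w], so additivity applies to an arbitrary [ur]. *)
  have tvr : class_entries (smooth_class (tempered setT)) (sub_mx ur w0).
    by move=> i j; rewrite mxE; exact: smooth_class_temperedB.
  have rvr : reps_mx v (sub_mx ur w0).
    move=> i j; apply: (reps_stable (rv0 i j)) (tvr i j) _; rewrite mxE.
    have := reps_sub (rur i j) (ru i j); congr (smooth_class _ _).
    by apply/funext => e; apply/funext => x; rewrite mxE; ring.
  have urE : ur = add_mx (sub_mx ur w0) w0.
    apply/matrixP => i j; rewrite !mxE; apply/funext => e; apply/funext => x.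
    by rewrite subrK.
  have h1 := smooth_classS (fun u => small_sub sJ)
    (solution_small r uT Sv rA rK rvr rfa0).
  have h2 := solution_small r uJ Sw rA rK rw0 rfc0.
  have h3 := residual_add omega Ar LK tvr tw0 (fdec _ _ _ rf rfa0 rfc0 r).
  have := smD _ _ (smD _ _ h1 h2) h3; congr (smooth_class _ _).
  by apply/funext => e; apply/funext => x; rewrite -urE; ring.
Qed.
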